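(* Let $J$ be a model structure on $\mathbb{R}^{2n}=\mathbb{C}^n$, with associated functions $\tilde{L}_{2n-1,k}$, $1\le k\le n-1$, and let $N$ be a germ of a $J$-complex hypersurface in $\mathbb{R}^{2n}$. (i) The model structure $J$ is integrable if and only if the functions $\tilde{L}_{2n-1,j}$ satisfy the compatibility conditions $$\frac{\partial \tilde{L}_{2n-1,k}}{\partial \overline{z}^j}=\frac{\partial \tilde{L}_{2n-1,j}}{\partial \overline{z}^k}\qquad\text{for every } 1\le j,k\le n-1.$$ In that case there exists a global diffeomorphism of $\mathbb{R}^{2n}$ which is $(J,J_{st})$-holomorphic. Moreover, in that case the germs of any $J$-complex hypersurface are given by one of the two following forms: (a) $N=A\times\mathbb{C}$, where $A$ is a germ of a $J_{st}$-complex hypersurface in $\mathbb{C}^{n-1}$; (b) $$N=\Big\{({}'z,z^n)\in\mathbb{C}^n: z^n=\frac{i}{4}\sum_{j=1}^{n-1}\overline{z}^j\tilde{L}_{2n-1,j}({}'z,{}'\overline{z})+\frac{i}{4}\sum_{j=1}^{n-1}\overline{z}^j\tilde{L}_{2n-1,j}({}'z,0)+\tilde{\varphi}({}'z)\Big\},$$ where $\tilde{\varphi}$ is a holomorphic function locally defined in $\mathbb{C}^{n-1}$. (ii) If $J$ is not integrable, then $N=A\times\mathbb{C}$, where $A$ is a germ of a $J_{st}$-complex hypersurface in $\mathbb{C}^{n-1}$.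
   Context: Write the coordinates of $\mathbb{C}^n=\mathbb{R}^{2n}$ as $z=({}'z,z^n)$ with ${}'z=(z^1,\dots,z^{n-1})$, $z^j=x^j+iy^j$, and let $J_{st}$ denote the standard complex structure. A model structure on $\mathbb{C}^n$ is an almost complex structure ($J^2=-\mathrm{Id}$) of the form $J(z)=J_{st}+L(z)$, where $L=(L_{j,k})_{1\le j,k\le 2n}$ is a real matrix (in the coordinates $(x^1,y^1,\dots,x^n,y^n)$) such that $L_{j,k}=0$ for $1\le j\le 2n-2$ and $1\le k\le 2n$, $L_{j,k}=0$ for $j,k\in\{2n-1,2n\}$, and the remaining entries (rows $2n-1,2n$, columns $1,\dots,2n-2$) are real linear forms in ${}'z$, i.e. of the form $\sum_{l=1}^{n-1}(a_l z^l+\overline{a_l}\,\overline{z}^l)$ with $a_l\in\mathbb{C}$ (depending on the entry). The complexification $J_{\mathbb{C}}$ of $J$ acts, in the basis $\partial/\partial z^k,\partial/\partial\overline{z}^k$, by $$J_{\mathbb{C}}\frac{\partial}{\partial \overline{z}^k}=-i\frac{\partial}{\partial\overline{z}^k}+\tilde{L}_{2n-1,k}\frac{\partial}{\partial z^n},\qquad J_{\mathbb{C}}\frac{\partial}{\partial z^k}=i\frac{\partial}{\partial z^k}+\overline{\tilde{L}_{2n-1,k}}\,\frac{\partial}{\partial \overline{z}^n}\qquad(1\le k\le n-1),$$ and $J_{\mathbb{C}}\,\partial/\partial z^n=i\,\partial/\partial z^n$, $J_{\mathbb{C}}\,\partial/\partial\overline{z}^n=-i\,\partial/\partial\overline{z}^n$.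 This defines the functions $\tilde{L}_{2n-1,k}({}'z,{}'\overline{z})=\sum_{l}(\alpha_l^k z^l+\beta_l^k\overline{z}^l)$, with $\alpha_l^k,\beta_l^k\in\mathbb{C}$; the notation $\tilde{L}_{2n-1,k}({}'z,0)$ means $\sum_l\alpha_l^k z^l$. A submanifold $N$ is $J$-complex if $J(TN)=TN$; a $J$-complex hypersurface is a $J$-complex submanifold of real codimension two. A map $F$ is $(J,J_{st})$-holomorphic if $dF\circ J=J_{st}\circ dF$. $J$ is integrable if near each point there are local coordinates in which $J$ becomes $J_{st}$.
   Formalization: In (i), the dichotomy (a)/(b) is stated at points of N near which z ↦ 'z restricted to N has constant rank (shown dense in N); at other points it fails, e.g. J = J_st and N = {z^1 = (z^2)^2} in C^2 at 0. *)

(* Defs.v *)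
From HB Require Import structures.
From mathcomp Require Import all_boot all_order all_algebra.
From mathcomp Require Import all_classical all_reals all_analysis.
From mathcomp Require Export complex.

Set Implicit Arguments.
Unset Strict Implicit.
Unset Printing Implicit Defensive.

Import Order.TTheory GRing.Theory Num.Theory.
Import numFieldNormedType.Exports.

Local Open Scope classical_set_scope.
Local Open Scope ring_scope.
Local Open Scope complex_scope.

(* C^n = R^{2n} is 'cV[R]_n.*2, with coordinates (x^1, y^1, .., x^n, y^n); the
   index j : 'I_n is 0-based, so z^j sits in rows 2j and 2j + 1. *)

Definition xidx (n : nat) (j : 'I_n) : 'I_n.*2 :=
  @Ordinal n.*2 j.*2 (etrans (ltn_double j n) (ltn_ord j)).

Definition yidx (n : nat) (j : 'I_n) : 'I_n.*2 :=
  @Ordinal n.*2 j.*2.+1 (etrans (ltn_Sdouble j n) (ltn_ord j)).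

Definition zcoord (R : realType) (n : nat) (z : 'cV[R]_n.*2) (j : 'I_n) : R[i] :=
  z (xidx j) 0 +i* z (yidx j) 0.

(* 'z in C^m for z = ('z, z^n) in C^n, n = m + 1. *)
Definition fstz (R : realType) (m : nat) (z : 'cV[R]_m.+1.*2) : 'cV[R]_m.*2 :=
  \col_i z (widen_ord (leq_trans (leqnSn _) (leqnSn _)) i) 0.

Definition lastz (R : realType) (m : nat) (z : 'cV[R]_m.+1.*2) : R[i] :=
  zcoord z ord_max.

(** * Smooth maps, diffeomorphisms, submanifolds *)

(* On an open set U, this is continuity of all iterated partial derivatives of
   order at most k. *)
Fixpoint Ck (R : realType) (V W : normedModType R) (k : nat) (U : set V)
    (f : V -> W) : Prop :=
  match k with
  | 0%N => forall x, U x -> {for x, continuous f}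
  | k'.+1 => (forall x, U x -> differentiable f x) /\
             (forall v : V, Ck k' U (fun x => 'd f x v))
  end.

Definition smooth_on (R : realType) (V W : normedModType R) (U : set V)
    (f : V -> W) : Prop := forall k, Ck k U f.

Definition diffeomorphism (R : realType) (V W : normedModType R)
    (U : set V) (U' : set W) (f : V -> W) (g : W -> V) : Prop :=
  [/\ open U, open U', f @` U = U', {in U, cancel f g}
    & smooth_on U f /\ smooth_on U' g].

Definition local_equation (R : realType) (d c : nat) (N : set 'cV[R]_d)
    (p : 'cV[R]_d) (U : set 'cV[R]_d) (g : 'cV[R]_d -> 'cV[R]_c) : Prop :=
  [/\ open U, U p, smooth_on U g,
      forall q, U q -> forall w : 'cV[R]_c, exists v, 'd g q v = w
    & N `&` U = [set q | U q /\ g q = 0]].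

Definition submanifold (R : realType) (d c : nat) (N : set 'cV[R]_d) : Prop :=
  forall p, N p -> exists U g, @local_equation R d c N p U g.

(* T_p N = ker dg_p for a local equation g of N at p; the kernel does not depend
   on the choice of g. *)
Definition tangent (R : realType) (d c : nat) (N : set 'cV[R]_d)
    (p : 'cV[R]_d) : set 'cV[R]_d :=
  [set v | exists U g, @local_equation R d c N p U g /\ 'd g p v = 0].

(** * Almost complex structures: J z acts on column tangent vectors at z *)

Definition almost_complex_map (R : realType) (d : nat) :=
  'cV[R]_d -> 'M[R]_d.

(* Jst (d/dx^j) = d/dy^j and Jst (d/dy^j) = - d/dx^j. *)
Definition Jst_mx (R : realType) (n : nat) : 'M[R]_n.*2 :=
  \matrix_(r, c) (if ~~ odd c && (r == c.+1 :> nat) then 1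
                  else if ~~ odd r && (c == r.+1 :> nat) then -1 else 0).

Definition Jst (R : realType) (n : nat) : almost_complex_map R n.*2 :=
  fun=> Jst_mx R n.

Definition holomorphic_on (R : realType) (d d' : nat) (U : set 'cV[R]_d)
    (J : almost_complex_map R d) (J' : almost_complex_map R d')
    (F : 'cV[R]_d -> 'cV[R]_d') : Prop :=
  forall q, U q -> differentiable F q /\
    forall v : 'cV[R]_d, 'd F q (J q *m v) = J' (F q) *m ('d F q v : 'cV[R]_d').

Definition integrable_structure (R : realType) (n : nat)
    (J : almost_complex_map R n.*2) : Prop :=
  forall p, exists U U' f g,
    [/\ U p, @diffeomorphism R _ _ U U' f g & holomorphic_on U J (@Jst R n) f].

(* A germ of J-complex hypersurface at p is represented by such an N with N p. *)
Definition complex_hypersurface (R : realType) (d : nat)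
    (J : almost_complex_map R d) (N : set 'cV[R]_d) : Prop :=
  submanifold 2 N /\
  forall p, N p -> [set J p *m v | v in tangent 2 N p] = tangent 2 N p.

(** * Model structures on C^n, n = m + 1 *)

Definition real_linear_form (R : realType) (m : nat)
    (h : 'cV[R]_m.+1.*2 -> R) : Prop :=
  exists a : 'I_m -> R[i], forall z,
    (h z)%:C = \sum_(l < m) (a l * zcoord (fstz z) l
                             + conjc (a l) * conjc (zcoord (fstz z) l)).

Definition model_structure (R : realType) (m : nat)
    (J : almost_complex_map R m.+1.*2) : Prop :=
  exists L : 'cV[R]_m.+1.*2 -> 'M[R]_m.+1.*2,
    [/\ forall z, J z = Jst_mx R m.+1 + L z,
        forall z (r c : 'I_m.+1.*2), (r < m.*2)%N -> L z r c = 0,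
        forall z (r c : 'I_m.+1.*2),
          (m.*2 <= r)%N -> (m.*2 <= c)%N -> L z r c = 0,
        forall r c : 'I_m.+1.*2, (m.*2 <= r)%N -> (c < m.*2)%N ->
          real_linear_form (fun z => L z r c)
      & forall z, J z *m J z = - 1%:M].

(* The complex tangent vectors d/dz^k = (d/dx^k - i d/dy^k) / 2 and
   d/dzbar^k = (d/dx^k + i d/dy^k) / 2. *)
Definition dz_vec (R : realType) (n : nat) (k : 'I_n) : 'cV[R[i]]_n.*2 :=
  2^-1 *: (delta_mx (xidx k) 0 - 'i%C *: delta_mx (yidx k) 0).

Definition dzbar_vec (R : realType) (n : nat) (k : 'I_n) : 'cV[R[i]]_n.*2 :=
  2^-1 *: (delta_mx (xidx k) 0 + 'i%C *: delta_mx (yidx k) 0).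

Definition complexified (R : realType) (d : nat) (A : 'M[R]_d) : 'M[R[i]]_d :=
  map_mx (real_complex R) A.

(* Ltilde alpha beta k zeta omega = sum_l (alpha_l^k zeta^l + beta_l^k omega^l),
   with alpha_l^k written alpha k l, so that Ltilde_{2n-1,k}('z, 'zbar) is
   obtained at omega = conj zeta and Ltilde_{2n-1,k}('z, 0) at omega = 0. *)
Definition Ltilde (R : realType) (m : nat) (alpha beta : 'I_m -> 'I_m -> R[i])
    (k : 'I_m) (zeta omega : 'I_m -> R[i]) : R[i] :=
  \sum_(l < m) (alpha k l * zeta l + beta k l * omega l).

Definition Ltilde_fun (R : realType) (m : nat)
    (alpha beta : 'I_m -> 'I_m -> R[i]) (k : 'I_m) (w : 'cV[R]_m.*2) : R[i] :=
  Ltilde alpha beta k (zcoord w) (fun l => conjc (zcoord w l)).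

Definition associated_functions (R : realType) (m : nat)
    (J : almost_complex_map R m.+1.*2)
    (alpha beta : 'I_m -> 'I_m -> R[i]) : Prop :=
  forall z (k : 'I_m),
    let k' := widen_ord (leqnSn m) k in
    let Lk := Ltilde_fun alpha beta k (fstz z) in
    complexified (J z) *m dzbar_vec R k'
      = - 'i%C *: dzbar_vec R k' + Lk *: dz_vec R ord_max /\
    complexified (J z) *m dz_vec R k'
      = 'i%C *: dz_vec R k' + conjc Lk *: dzbar_vec R ord_max.

(* d f / d zbar^j = (df/dx^j + i df/dy^j) / 2. *)
Definition dbar (R : realType) (m : nat) (j : 'I_m)
    (f : 'cV[R]_m.*2 -> R[i]) (w : 'cV[R]_m.*2) : R[i] :=
  let D (v : 'cV[R]_m.*2) : R[i] :=
    'D_v (fun u => complex.Re (f u) : R) w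
      +i* 'D_v (fun u => complex.Im (f u) : R) w in
  2^-1 * (D (delta_mx (xidx j) 0) + 'i%C * D (delta_mx (yidx j) 0)).

Definition compatible (R : realType) (m : nat)
    (alpha beta : 'I_m -> 'I_m -> R[i]) : Prop :=
  forall (j k : 'I_m) w,
    dbar j (Ltilde_fun alpha beta k) w = dbar k (Ltilde_fun alpha beta j) w.

(** * The two normal forms of a germ (N, p), and regular germs *)

Definition cylinder_germ (R : realType) (m : nat) (N : set 'cV[R]_m.+1.*2)
    (p : 'cV[R]_m.+1.*2) : Prop :=
  exists A : set 'cV[R]_m.*2,
    [/\ complex_hypersurface (@Jst R m) A, A (fstz p)
      & \forall q \near p, N q <-> A (fstz q)].

Definition graph_germ (R : realType) (m : nat)
    (alpha beta : 'I_m -> 'I_m -> R[i]) (N : set 'cV[R]_m.+1.*2)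
    (p : 'cV[R]_m.+1.*2) : Prop :=
  exists (W : set 'cV[R]_m.*2) (phi : 'cV[R]_m.*2 -> 'cV[R]_1.*2),
    [/\ open W, W (fstz p), holomorphic_on W (@Jst R m) (@Jst R 1) phi
      & \forall q \near p, N q <->
          lastz q =
            'i%C / 4 * (\sum_(j < m) conjc (zcoord (fstz q) j)
                        * Ltilde_fun alpha beta j (fstz q))
            + 'i%C / 4 * (\sum_(j < m) conjc (zcoord (fstz q) j)
                        * Ltilde alpha beta j (zcoord (fstz q)) (fun=> 0))
            + zcoord (phi (fstz q)) ord0].

(* The restriction to N of the projection z |-> 'z has rank r at q. *)
Definition projection_rank (R : realType) (m : nat) (N : set 'cV[R]_m.+1.*2)
    (q : 'cV[R]_m.+1.*2) (r : nat) : Prop :=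
  exists B : 'M[R]_(m.*2, r),
    \rank B = r /\ @fstz R m @` tangent 2 N q = range (fun u : 'cV[R]_r => B *m u).

(* Germs at which z |-> 'z restricted to N has locally constant rank.  At other
   points neither normal form can hold, e.g. J = Jst and N = {z^1 = (z^2)^2} in
   C^2 at the origin. *)
Definition regular_germ (R : realType) (m : nat) (N : set 'cV[R]_m.+1.*2)
    (p : 'cV[R]_m.+1.*2) : Prop :=
  exists r, \forall q \near p, N q -> projection_rank N q r.

(* Main.v *)
(** Write L('z)v for the complex z^n-component of (J - J_st)v, so that
    L('z)v = sum_k conj(v^k) Ltilde_k('z, conj 'z).  A J-complex hypersurface N
    is at each point either tangent to the vertical z^n-line or transversal to it,
    since the tangent space meets that line in a complex subspace.

    Near a transversal point, N is a graph z^n = psi('z), and N is J-complex iff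
    d psi(iv) = i d psi(v) + L('z)v.  Differentiating this along u and using the
    symmetry of d^2 psi gives d L(iu)v - i d L(u)v = d L(iv)u - i d L(v)u, which
    says that beta is symmetric, i.e. that the compatibility conditions hold.
    Conversely, if beta is symmetric then the explicit quadratic polynomial corr
    of the normal form (b) solves the equation; hence ('z, z^n - corr('z)) is a
    global holomorphic chart, and psi - corr is holomorphic.  An integrable J has
    transversal hypersurfaces, the level sets of a component of a chart, so
    integrability implies compatibility.

    If N is vertical at all points near p, then near p it is a cylinder.

    The analytic input is an implicit function theorem for R^2-valued equations. *)

From HB Require Import structures.
Require Import Defs.
From mathcomp Require Import all_boot all_order all_algebra.
From mathcomp Require Import all_classical all_reals all_analysis.
From mathcomp Require Import ring lra.

Set Implicit Arguments.
Unset Strict Implicit.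
Unset Printing Implicit Defensive.

Import Order.TTheory GRing.Theory Num.Theory.
Import numFieldNormedType.Exports.

Local Open Scope classical_set_scope.
Local Open Scope complex_scope.
Local Open Scope ring_scope.

(** * Differential calculus on column vectors *)

(** The implicit function theorem is stated without splitting coordinates. For a right inverse [B]
    of ['d g p], a function u on a ball about p in the whole space solves g (x + B u(x)) = 0, so
    that near p the set N is at once the zero set of u and the image of x |-> x + B u(x). A vertical
    [B] yields graphs, a horizontal one cylinders.

    The function u is only shown to be differentiable with differentiable first derivatives. This
    suffices: the symmetry of second derivatives is proved without their continuity, holomorphy asks
    for differentiability alone, and the smooth equation required of the base of a cylinder is a
    slice of the equation of N.

    In the integrable case neither normal form is available at a vertical point that is a limit of
    transversal ones. The projection to 'z has rank 2m at transversal points and 2m - 2 at vertical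
    ones, so a locally constant rank rules this out. In the non-integrable case a single transversal
    point would already make J integrable. *)

Lemma cV_entry_norm (R : realType) n (x : 'cV[R]_n) i : `|x i 0| <= `|x|.
Proof.
rewrite [leRHS]/Num.norm /= mx_normrE; apply/bigmax_geP; right => /=.
by exists (i, 0).
Qed.

Lemma cV_norm_le (R : realType) n (x : 'cV[R]_n) e :
  0 <= e -> (forall i, `|x i 0| <= e) -> `|x| <= e.
Proof.
move=> e0 xe; rewrite [leLHS]/Num.norm /= mx_normrE; apply/bigmax_leP; split=> //.
by case=> i j _; rewrite ord1 /=; exact: xe.
Qed.

Lemma cV_sum_delta (R : realType) n (x : 'cV[R]_n) :
  x = \sum_i x i 0 *: delta_mx i 0.
Proof.
by rewrite {1}(matrix_sum_delta x); apply: eq_bigr => i _; rewrite big_ord1.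
Qed.

Lemma linear_cV_norm (R : realType) n (W : normedModType R)
    (L : {linear 'cV[R]_n -> W}) e (v : 'cV[R]_n) :
  0 <= e -> (forall i, `|L (delta_mx i 0)| <= e) -> `|L v| <= n%:R * e * `|v|.
Proof.
move=> e0 Le; rewrite {1}(cV_sum_delta v) linear_sum.
apply: (le_trans (ler_norm_sum _ _ _)).
rewrite [leRHS](_ : _ = \sum_(i < n) (`|v| * e)); last first.
  by rewrite sumr_const card_ord -mulr_natl; ring.
by apply: ler_sum => i _; rewrite linearZ normrZ ler_pM // cV_entry_norm.
Qed.

Lemma linear_cV_continuous (R : realType) n (W : normedModType R)
    (L : {linear 'cV[R]_n -> W}) : continuous L.
Proof.
apply: bounded_linear_continuous; rewrite -bounded_funP => r.
pose e := \sum_i `|L (delta_mx i 0)|.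
have e0 : 0 <= e by apply: sumr_ge0.
exists (n%:R * e * r) => x xr.
apply: (le_trans (linear_cV_norm x e0 _)).
  by move=> i; rewrite /e (bigD1 i) //= lerDl sumr_ge0.
by rewrite ler_wpM2l // mulr_ge0.
Qed.

Section Differentials.
Context {R : realType} {V W : normedModType R}.
Implicit Types (f : V -> W) (x : V).

Lemma diff_eps f x : differentiable f x -> forall e, 0 < e ->
  \forall h \near 0, `|f (h + x) - f x - 'd f x h| <= e * `|h|.
Proof.
move=> /diff_locallyxP[_ df] e e0.
have /eqaddoP/(_ _ e0) : f \o shift x = cst (f x) + 'd f x +o_ 0 id.
  by apply/eqaddoE; rewrite funeqE => h; rewrite /= df.
apply: filterS => h /=.
by rewrite !fctE /= opprD addrA.
Qed.

(** Together with [diff_eps], this trades the little-o form of the derivative for epsilon estimates,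
    in which explicit constants can be tracked. *)
Lemma eps_is_diff f x (df : {linear V -> W}) : continuous df ->
  (forall e, 0 < e ->
    \forall h \near 0, `|f (h + x) - f x - df h| <= e * `|h|) ->
  is_diff x f df.
Proof.
move=> cdf H.
have E : f \o shift x = cst (f x) + df +o_ 0 id.
  apply/eqaddoP => e e0; apply: filterS (H e e0) => h.
  by rewrite !fctE /= opprD addrA.
have D := diff_unique cdf E.
by apply: DiffDef => //; apply/diff_locallyP; rewrite D; split.
Qed.

Lemma near_eq_is_diff f g x (df : V -> W) :
  {near x, f =1 g} -> is_diff x f df -> is_diff x g df.
Proof.
move=> fg [dfx <-]; apply: eps_is_diff => [|e e0]; first exact: diff_continuous.
have fg0 : \forall h \near 0, f (h + x) = g (h + x).
  by move: (fg); rewrite (near_shift 0) /= subr0.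
have := diff_eps dfx e0; apply: filterS2 fg0 => h <-.
by rewrite (nbhs_singleton fg).
Qed.

End Differentials.

Lemma is_diff_coord (R : realType) (V : normedModType R) n (f : V -> 'cV[R]_n)
    (df : V -> 'cV[R]_n) x i :
  is_diff x f df -> is_diff x (fun y => f y i 0) (fun v => df v i 0).
Proof.
move=> [dfx <-].
pose L (N : 'cV[R]_n) : R := N i 0.
have Ll : linear L by move=> a u v; rewrite /L !mxE.
pose LL : {linear 'cV[R]_n -> R} :=
  HB.pack L (GRing.isLinear.Build _ _ _ _ L Ll).
have cL := @linear_cV_continuous _ _ _ LL.
have dL y : differentiable LL y by exact: linear_differentiable.
have dLE y : 'd LL y = LL :> (_ -> _) by exact: diff_lin.
have [dc] := is_diff_comp (differentiableP dfx) (differentiableP (dL (f x))).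
by rewrite dLE => E; apply: DiffDef.
Qed.

Lemma is_derive_line (R : realType) (V : normedModType R) (f : V -> R) (x v : V)
    (t : R) :
  differentiable f (x + t *: v) ->
  is_derive t 1 (fun s : R => f (x + s *: v)) ('d f (x + t *: v) v).
Proof.
move=> df.
have dl : is_diff t (fun s : R => x + s *: v) (fun s => s *: v).
  by rewrite -[X in is_diff _ _ X]add0r; exact: is_diffD.
have := @is_diff_comp _ _ _ _ _ _ f _ _ dl (differentiableP df).
move=> [dc vc]; apply: DeriveDef; first exact: diff_derivable.
by rewrite deriveE // [X in X 1]vc /= scale1r.
Qed.

Lemma line_MVT (R : realType) (V : normedModType R) (f : V -> R) (x v : V) :
  (forall t, 0 <= t <= 1 -> differentiable f (x + t *: v)) ->
  exists2 t : R, 0 < t < 1 & f (x + v) - f x = 'd f (x + t *: v) v.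
Proof.
move=> df.
have [||t] := @MVT R (fun s => f (x + s *: v))
  (fun s => 'd f (x + s *: v) v) 0 1 ltr01.
- move=> t; rewrite in_itv /= => /andP[t0 t1]; apply: is_derive_line.
  by apply: df; rewrite !ltW.
- apply: derivable_within_continuous => t; rewrite in_itv /= => /df.
  by move=> /is_derive_line [].
rewrite in_itv /= => t01; rewrite scale1r scale0r addr0 subr0 mulr1 => E.
by exists t.
Qed.

Definition lmx (R : realType) n c (f : 'cV[R]_n -> 'cV[R]_c) : 'M[R]_(c, n) :=
  \matrix_(i, j) f (delta_mx j 0) i 0.

Lemma mul_lmx (R : realType) n c (f : {linear 'cV[R]_n -> 'cV[R]_c}) v :
  lmx f *m v = f v.
Proof.
rewrite [in RHS](cV_sum_delta v) linear_sum; apply/matrixP => i j.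
rewrite ord1 mxE summxE; apply: eq_bigr => k _.
by rewrite linearZ !mxE mulrC.
Qed.

Lemma mulmx_ball (R : realType) n c (A : 'M[R]_(c, n)) :
  exists2 K : R, 1 <= K & forall v : 'cV[R]_n, `|A *m v| <= K * `|v|.
Proof.
have [k k0 Hk] := linear_lipschitz (@linear_cV_continuous R n _ (mulmx A)).
exists (k + 1); first by rewrite lerDr ltW.
by move=> v; apply: le_trans (Hk v) _; rewrite ler_wpM2r // lerDl.
Qed.

Lemma inj_unitmx (R : realType) n (A : 'M[R]_n) :
  (forall v : 'cV[R]_n, A *m v = 0 -> v = 0) -> A \in unitmx.
Proof.
move=> Ainj; rewrite unitmxE unitfE; apply/negP; rewrite -det_tr.
move=> /det0P[v v0 vA]; move/negP: v0; apply.
have /Ainj/(congr1 trmx) : A *m v^T = 0 by rewrite -[A]trmxK -trmx_mul vA trmx0.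
by rewrite trmxK trmx0 => ->.
Qed.

Lemma normB_segment (R : realType) (V : normedModType R) (p x y : V) (r t : R) :
  0 <= t <= 1 -> `|p - x| < r -> `|p - y| < r -> `|p - (x + t *: (y - x))| < r.
Proof.
move=> /andP[t0 t1] px py.
have -> : p - (x + t *: (y - x)) = (1 - t) *: (p - x) + t *: (p - y).
  rewrite opprD addrA -scalerN opprB -[x - y](subrKA p) scalerDr addrA.
  by rewrite scalerBl scale1r -[in RHS]scalerN opprB.
apply: (le_lt_trans (ler_normD _ _)); rewrite !normrZ !ger0_norm ?subr_ge0 //.
have [->|tn] := eqVneq t 1; first by rewrite subrr mul0r add0r mul1r.
have t1' : 0 < 1 - t by rewrite subr_gt0 lt_neqAle tn.
rewrite [ltRHS](_ : r = (1 - t) * r + t * r); last by ring.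
by rewrite ltr_leD // ?ltr_pM2l // ler_wpM2l // ltW.
Qed.

(** Continuity of the partial derivatives makes ['d g] uniformly close to ['d g p] on a ball. The
    mean value theorem along segments turns this into the last estimate; it is applied to each
    coordinate because the intermediate point depends on the coordinate. *)
Lemma strict_diff (R : realType) n c (U : set 'cV[R]_n)
    (g : 'cV[R]_n -> 'cV[R]_c) p (e : R) :
  open U -> U p -> Ck 1 U g -> 0 < e ->
  exists r : R, [/\ 0 < r, ball p r `<=` U,
    forall y, ball p r y -> forall h, `|'d g y h - 'd g p h| <= e * `|h|
    & forall x y, ball p r x -> ball p r y ->
        `|g y - g x - 'd g p (y - x)| <= e * `|y - x|].
Proof.
move=> oU Up [dg cg] e0.
have n0 : 0 < n.+1%:R :> R by rewrite ltr0n.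
(* [linear_cV_norm] loses a factor n over the bound on basis vectors; [n.+1] avoids dividing by
   zero. *)
pose e' := e / n.+1%:R; have e'0 : 0 < e' by rewrite divr_gt0.
have near_e : \forall y \near p, forall j : 'I_n,
    `|'d g p (delta_mx j 0) - 'd g y (delta_mx j 0)| < e'.
  apply: (@filter_forall _ _ (fun (j : 'I_n) (y : 'cV[R]_n) =>
    `|'d g p (delta_mx j 0) - 'd g y (delta_mx j 0)| < e' : Prop) (nbhs p)) => j.
  by have := cg (delta_mx j 0) p Up => /cvgrPdist_lt/(_ e' e'0).
have : \forall y \near p, U y /\ forall j : 'I_n,
    `|'d g p (delta_mx j 0) - 'd g y (delta_mx j 0)| < e'.
  by apply: filterI => //; exact: open_nbhs_nbhs.
move=> /nbhs_ballP[r /= r0 Hr].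
have dd y : ball p r y -> forall h, `|'d g y h - 'd g p h| <= e * `|h|.
  move=> /Hr[Uy Hy] h.
  have -> : 'd g y h - 'd g p h = ('d g y \- 'd g p) h by [].
  apply: le_trans (linear_cV_norm h (ltW e'0) _) _.
    by move=> i /=; rewrite distrC ltW.
  rewrite ler_wpM2r // /e' mulrC -mulrA ler_piMr //; first exact: ltW.
  by rewrite mulrC ler_pdivrMr // mul1r ler_nat.
exists r; split=> //; first by move=> y /Hr[].
move=> x y; rewrite -ball_normE => px py.
apply: cV_norm_le => [|i]; first by rewrite mulr_ge0 // ltW.
have seg t : 0 <= t <= 1 -> ball p r (x + t *: (y - x)).
  by move=> t01; rewrite -ball_normE /=; exact: normB_segment.
have [|t /andP[t0 t1]] := @line_MVT R _ (fun z => g z i 0) x (y - x).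
  move=> t /seg/Hr[Uz _].
  by have [] := is_diff_coord i (differentiableP (dg _ Uz)).
have /seg bz : 0 <= t <= 1 by rewrite !ltW.
have [Uz _] := Hr _ bz.
have [_ ->] := is_diff_coord i (differentiableP (dg _ Uz)).
rewrite addrCA subrr addr0 => E; rewrite !mxE E.
apply: le_trans (dd _ bz (y - x)).
by apply: le_trans (cV_entry_norm _ i); rewrite !mxE.
Qed.

Lemma differentiable_cV (R : realType) (V : normedModType R) n
    (f : V -> 'cV[R]_n) x :
  (forall i, differentiable (fun y => f y i 0) x) -> differentiable f x.
Proof.
move=> df.
have -> : f = \sum_(i < n) (fun y => f y i 0 *: delta_mx i 0).
  by apply/funext => y; rewrite fct_sumE -cV_sum_delta.
by apply: differentiable_sum => i; exact: differentiableZl.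
Qed.

Lemma near_eq_differentiable (R : realType) (V W : normedModType R)
    (f g : V -> W) x :
  {near x, f =1 g} -> differentiable f x -> differentiable g x.
Proof. by move=> fg /differentiableP df; have [] := near_eq_is_diff fg df. Qed.

(** No regularity of [f] and [h] is assumed: Cramer's rule writes [f] near x as a quotient of
    differentiable functions. Solutions of linear systems are thus differentiated without
    differentiating a matrix inverse. *)
Lemma cramer_differentiable (R : realType) (V : normedModType R)
    (a b c d s t f h : V -> R) x :
  differentiable a x -> differentiable b x -> differentiable c x ->
  differentiable d x -> differentiable s x -> differentiable t x ->
  a x * d x - b x * c x != 0 ->
  (\forall y \near x, a y * f y + b y * h y = s y /\
                      c y * f y + d y * h y = t y) ->
  differentiable f x.
Proof.
move=> da db dc dd ds dt det0 E.
have ddet : differentiable (a * d - b * c) x.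
  by apply: differentiableB; apply: differentiableM.
have dnum : differentiable (d * s - b * t) x.
  by apply: differentiableB; apply: differentiableM.
have det_near : \forall y \near x, (a * d - b * c) y != 0.
  have /cvgrPdist_lt := differentiable_continuous ddet.
  move=> /(_ `|(a * d - b * c) x|); rewrite normr_gt0 => /(_ det0).
  apply: filterS => y; apply: contraTneq => ->.
  by rewrite subr0 ltxx.
apply: (@near_eq_differentiable _ _ _
  ((d * s - b * t) * (fun y => ((a * d - b * c) y)^-1))); last first.
  by apply: differentiableM => //; exact: differentiableV.
apply: filterS2 E det_near => y [Es Et] D.
have {}D : a y * d y - b y * c y != 0 by exact: D.
change ((d y * s y - b y * t y) / (a y * d y - b y * c y) = f y).
by apply: (mulIf D); rewrite -mulrA mulVf // mulr1 -Es -Et; ring.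
Qed.

(** * An implicit function theorem *)

(* The join of the complete and normed structures of ['cV[R]_n], not declared
   by the library. *)
HB.instance Definition _ (R : realType) n := Complete.copy 'cV[R]_n 'cV[R]_n.
Lemma fixed_point_closed_ball (R : realType) c (T : 'cV[R]_c -> 'cV[R]_c) r :
  0 <= r -> (forall v, `|v| <= r -> `|T v| <= r) ->
  (forall v w, `|v| <= r -> `|w| <= r -> `|T v - T w| <= 2^-1 * `|v - w|) ->
  exists2 v, `|v| <= r & T v = v.
Proof.
move=> r0 TS Tc.
pose A := [set v : 'cV[R]_c | `|v| <= r].
have Tfun : {homo T : x / A x >-> A x} by move=> v; exact: TS.
pose TT : {fun A >-> A} := HB.pack T (isFun.Build _ _ A A T Tfun).
have [|||v Av E] := @banach_fixed_point R _ _ TT.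
- exists (2^-1)%:nng; split; first by rewrite /= invf_lt1 // ltr1n.
  by move=> [v w] [Av Aw]; exact: Tc.
- rewrite (_ : A = closed_ball_ Num.norm 0 r); last first.
    by apply/seteqP; split=> v; rewrite /closed_ball_ /A /= sub0r normrN.
  exact: closed_closed_ball_.
- by exists 0; rewrite /A /= normr0.
by exists v.
Qed.

Lemma det2E (R : comNzRingType) (A : 'M[R]_2) :
  \det A = A 0 0 * A 1 1 - A 0 1 * A 1 0.
Proof.
rewrite (expand_det_row _ 0) !big_ord_recl big_ord0 addr0.
rewrite /cofactor !det_mx11 !mxE /= expr0 mul1r expr1 mulN1r mulrN.
by congr (_ * A _ _ - A _ _ * A _ _); exact/val_inj.
Qed.

Lemma mulmx2E (R : comNzRingType) (A : 'M[R]_2) (b c : 'cV[R]_2) :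
  A *m b = c -> forall i, A i 0 * b 0 0 + A i 1 * b 1 0 = c i 0.
Proof.
move=> <- i; rewrite !mxE !big_ord_recl big_ord0 addr0.
by congr (_ + A _ _ * b _ _); exact/val_inj.
Qed.

Lemma mulmx2_solve_differentiable (R : realType) (V : normedModType R)
    (A : V -> 'M[R]_2) (b c : V -> 'cV[R]_2) x :
  (forall i j, differentiable (fun y => A y i j) x) ->
  (forall i, differentiable (fun y => c y i 0) x) ->
  A x \in unitmx -> (\forall y \near x, A y *m b y = c y) ->
  differentiable b x.
Proof.
move=> dA dc Au E.
have det0 : A x 0 0 * A x 1 1 - A x 0 1 * A x 1 0 != 0.
  by have := Au; rewrite unitmxE unitfE det2E.
have Eq i : \forall y \near x, A y i 0 * b y 0 0 + A y i 1 * b y 1 0 = c y i 0.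
  by apply: filterS E => y /mulmx2E; apply.
apply: differentiable_cV => i.
have [->|->] : i = 0 \/ i = 1.
  by case: i => [[|[|//]] hi]; [left|right]; exact/val_inj.
- apply: (cramer_differentiable (dA 0 0) (dA 0 1) (dA 1 0) (dA 1 1)
    (dc 0) (dc 1) det0 (h := fun y => b y 1 0)).
  by apply: filterS2 (Eq 0) (Eq 1).
- apply: (cramer_differentiable (dA 0 1) (dA 0 0) (dA 1 1) (dA 1 0)
    (dc 0) (dc 1) (h := fun y => b y 0 0)).
    by rewrite -opprB oppr_eq0.
  by apply: filterS2 (Eq 0) (Eq 1) => y <- <-; split; rewrite addrC.
Qed.

Section Implicit.
Variables (R : realType) (n : nat) (U : set 'cV[R]_n) (g : 'cV[R]_n -> 'cV[R]_2).
Variables (p : 'cV[R]_n) (B : 'M[R]_(n, 2)).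
Hypotheses (oU : open U) (Up : U p) (sg : smooth_on U g) (gp : g p = 0).
Hypothesis (dB : forall v : 'cV[R]_2, 'd g p (B *m v) = v).

(** Since [B] is a right inverse of ['d g p], strict differentiability makes v |-> g (x + B v)
    differ from a translation by a 1/2-Lipschitz map. The tolerance (2K)^-1 absorbs the norm bound K
    of [B], and K >= 1 makes it at most 1/2. *)
Lemma implicit_near : exists (K r : R), [/\ 1 <= K, 0 < r, ball p r `<=` U,
  (forall v : 'cV[R]_2, `|B *m v| <= K * `|v|) &
  [/\ forall y, ball p r y -> forall v : 'cV[R]_2,
        `|'d g y (B *m v) - v| <= 2^-1 * `|v|,
      forall x v, ball p r x -> ball p r (x + B *m v) ->
        `|g (x + B *m v) - g x - v| <= 2^-1 * `|v|
    & forall x y, ball p r x -> ball p r y ->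
        `|g y - g x - 'd g p (y - x)| <= (2 * K)^-1 * `|y - x|]].
Proof.
have [K K1 BK] := mulmx_ball B.
have K0 : 0 < K by apply: lt_le_trans K1.
have e0 : 0 < (2 * K)^-1 by rewrite invr_gt0 mulr_gt0.
have [r [r0 rU dd sd]] := strict_diff oU Up (sg 1) e0.
have eK (v : 'cV[R]_2) : (2 * K)^-1 * `|B *m v| <= 2^-1 * `|v|.
  apply: le_trans (ler_wpM2l (ltW e0) (BK v)) _.
  by rewrite invfM -mulrA [_^-1 * (K * _)]mulrA mulVf ?gt_eqF // mul1r.
exists K, r; split=> //; split=> // [y py v|x v px pxv].
  by rewrite -{2}[v]dB; apply: le_trans (dd _ py _) _.
have := sd _ _ px pxv; rewrite [x + _ - x]addrAC subrr add0r dB => H.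
by apply: le_trans H _.
Qed.

Lemma half_norm_eq0 (V : normedModType R) (v : V) :
  `|v| <= 2^-1 * `|v| -> v = 0.
Proof.
move=> H; apply/eqP; rewrite -normr_eq0 eq_le normr_ge0 andbT.
by have := normr_ge0 v; lra.
Qed.

(** [u x] is the fixed point of v |-> v - g (x + B v), which is 1/2-Lipschitz. Differentiability of
    ['d u y k] in y is included because the symmetry of second derivatives is later applied to
    graphs obtained from u. *)
Lemma implicit : exists r s (u : 'cV[R]_n -> 'cV[R]_2),
  [/\ 0 < s, ball p s `<=` ball p r, ball p r `<=` U,
    (forall y, ball p r y -> forall v : 'cV[R]_2, 'd g y (B *m v) = 0 -> v = 0)
  & forall x, ball p s x ->
    [/\ ball p r (x + B *m u x), g (x + B *m u x) = 0,
        (forall v, ball p r (x + B *m v) -> g (x + B *m v) = 0 -> v = u x),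
        differentiable u x
      & (forall k, 'd g (x + B *m u x) (k + B *m 'd u x k) = 0) /\
        (forall k, differentiable (fun y => 'd u y k) x)]].
Proof.
have [K [r [K1 r0 rU BK [dgB gB sd]]]] := implicit_near.
have K0 : 0 < K by apply: lt_le_trans K1.
have binj y : ball p r y -> forall v : 'cV[R]_2, 'd g y (B *m v) = 0 -> v = 0.
  move=> py v E; apply: half_norm_eq0; have := dgB _ py v.
  by rewrite E sub0r normrN.
have gB2 x v w : ball p r (x + B *m v) -> ball p r (x + B *m w) ->
    `|g (x + B *m v) - g (x + B *m w) - (v - w)| <= 2^-1 * `|v - w|.
  move=> pv pw; have := gB (x + B *m w) (v - w) pw.
  by rewrite -addrA -mulmxDr [w + _]addrC subrK => /(_ pv).
have guniq x v w : ball p r (x + B *m v) -> ball p r (x + B *m w) ->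
    g (x + B *m v) = 0 -> g (x + B *m w) = 0 -> v = w.
  move=> pv pw gv gw; apply/eqP; rewrite -subr_eq0; apply/eqP.
  apply: half_norm_eq0; have := gB2 x v w pv pw.
  by rewrite gv gw subrr sub0r normrN.
(* The fixed point is sought in |v| <= 2 |g x|, as the map has norm at most |v|/2 + |g x| there.
   Then |B v| <= 2 K |g x| < r/2, which with |p - x| < r/2 keeps x + B v in the ball. *)
have g0 : \forall x \near p, `|g x| < r / (4 * K).
  have /cvgrPdist_lt := differentiable_continuous ((sg 1).1 _ Up).
  move=> /(_ (r / (4 * K))); rewrite divr_gt0 ?mulr_gt0 // => /(_ isT).
  by apply: filterS => x; rewrite gp sub0r normrN.
have /nbhs_ballP[s1 /= s10 Hs1] := g0.
pose s := Num.min s1 (r / 2).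
have s0 : 0 < s by rewrite lt_min s10 divr_gt0.
have sr : ball p s `<=` ball p r.
  move=> x; apply: le_ball; rewrite ge_min; apply/orP; right.
  by rewrite ler_pdivrMr // ler_peMr ?ltW // ltr1n.
have ex_u x : exists v, ball p s x ->
    ball p r (x + B *m v) /\ g (x + B *m v) = 0.
  have [px|] := pselect (ball p s x); last by exists 0.
  have gx : `|g x| < r / (4 * K).
    by apply: Hs1; apply: le_ball px; rewrite ge_min lexx.
  have pxr : `|p - x| < r / 2.
    by move: px; rewrite -ball_normE /= => /lt_le_trans; apply;
       rewrite ge_min lexx orbT.
  have inr v : `|v| <= 2 * `|g x| -> ball p r (x + B *m v).
    move=> vg; rewrite -ball_normE /= opprD addrA.
    apply: le_lt_trans (ler_normB _ _) _.
    rewrite [r in ltRHS]splitr; apply: ltr_leD => //.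
    apply: le_trans (BK v) _; rewrite mulrC -ler_pdivlMr //.
    apply: le_trans vg _; rewrite -ler_pdivlMl //.
    apply: le_trans (ltW gx) _; rewrite le_eqVlt; apply/orP; left; apply/eqP.
    by field; rewrite gt_eqF.
  have [|v vg||v vg E] := @fixed_point_closed_ball R 2
    (fun v => v - g (x + B *m v)) (2 * `|g x|).
  - by rewrite mulr_ge0.
  - have := gB x v (sr _ px) (inr _ vg).
    rewrite -normrN !opprD !opprK => H.
    rewrite (_ : _ - _ = - g (x + B *m v) + g x + v - g x); last first.
      by rewrite [RHS]addrAC -addrA [in RHS]addrA addrK addrC.
    apply: le_trans (ler_normB _ _) _.
    have := normr_ge0 (g x); lra.
  - move=> v w vg wg.
    have := gB2 x v w (inr _ vg) (inr _ wg).
    rewrite -normrN; congr (`|_| <= _).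
    by rewrite !opprB addrACA [in RHS]addrACA [- w - _]addrC.
  - exists v => _; split; first exact: inr.
    by move/eqP: E; rewrite eq_sym -subr_eq0 opprB addrC subrK => /eqP.
have [u Hu] := choice ex_u.
have [D D0 HD] := linear_lipschitz (diff_continuous ((sg 1).1 _ Up)).
have near_s x : ball p s x -> \forall y \near x, ball p s y.
  by move=> px; apply: open_nbhs_nbhs; split => //; exact: ball_open.
pose G x := x + B *m u x.
(* [g] vanishes at both x + B u(x) and y + B u(y), so the strict estimate bounds the norm of 'd g p
   (y - x) + (u y - u x) by (|y - x| + |u y - u x|) / 2. The half of |u y - u x| is absorbed on the
   left. *)
have lip x y : ball p s x -> ball p s y ->
    `|u y - u x| <= 2 * (D + 1) * `|y - x|.
  move=> px py; have [px' gx] := Hu x px; have [py' gy] := Hu y py.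
  have := sd _ _ px' py'; rewrite gx gy subrr sub0r normrN.
  have -> : y + B *m u y - (x + B *m u x) = (y - x) + B *m (u y - u x).
    by rewrite mulmxBr opprD addrACA.
  rewrite linearD /= dB => H.
  have H1 : `|u y - u x| <= `|'d g p (y - x) + (u y - u x)| + `|'d g p (y - x)|.
    have := ler_normB ('d g p (y - x) + (u y - u x)) ('d g p (y - x)).
    by rewrite addrAC subrr add0r.
  have H2 : (2 * K)^-1 * `|y - x + B *m (u y - u x)| <=
      2^-1 * `|y - x| + 2^-1 * `|u y - u x|.
    apply: le_trans (_ : _ <= (2 * K)^-1 * (`|y - x| + K * `|u y - u x|)) _.
      rewrite ler_pM2l ?invr_gt0 ?mulr_gt0 //.
      by apply: le_trans (ler_normD _ _) _; rewrite lerD2l.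
    rewrite mulrDr invfM; apply: lerD.
      rewrite ler_wpM2r // ler_piMr // invf_le1 //.
    by rewrite -mulrA [_^-1 * (K * _)]mulrA mulVf ?gt_eqF // mul1r.
  have := HD (y - x); have := normr_ge0 (y - x); lra.
pose N y : {linear 'cV[R]_2 -> 'cV[R]_2} := 'd g (G y) \o mulmx B.
have NE y v : lmx (N y) *m v = 'd g (G y) (B *m v) by rewrite mul_lmx.
have Nu y : ball p s y -> lmx (N y) \in unitmx.
  move=> py; apply: inj_unitmx => v; rewrite NE; apply: binj.
  by have [] := Hu y py.
have du x : ball p s x -> is_diff x u
    (mulmx (- invmx (lmx (N x))) \o 'd g (G x)).
  move=> px; have [pG gG] := Hu x px; have UG := rU _ pG.
  pose L : {linear 'cV[R]_n -> 'cV[R]_2} :=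
    mulmx (- invmx (lmx (N x))) \o 'd g (G x).
  have NL k : lmx (N x) *m L k = - 'd g (G x) k.
    by rewrite /L /= mulNmx mulmxN mulKVmx // Nu.
  have cL : continuous L := @linear_cV_continuous _ _ _ L.
  apply: (eps_is_diff cL) => e e0.
  pose C := 2 * (D + 1); have C0 : 0 < C by rewrite mulr_gt0 // addr_gt0.
  (* [C] is the Lipschitz constant of u, so |k + B d| <= M |k| for the increment d of u. The 2 in e
     / (2 M) pays for bounding the error w = L k - d by 2 |N w|, which holds because N is within 1/2
     of the identity. *)
  pose M := 1 + K * C; have M0 : 0 < M by rewrite addr_gt0 // mulr_gt0.
  have e'0 : 0 < e / (2 * M) by rewrite divr_gt0 // mulr_gt0.
  have /nbhs_ballP[q /= q0 Hq] := diff_eps ((sg 1).1 _ UG) e'0.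
  have kq : \forall k \near 0, `|k : 'cV[R]_n| < q / M.
    apply/nbhs_ballP; exists (q / M); first by rewrite /= divr_gt0.
    by move=> k; rewrite -ball_normE /= sub0r normrN.
  have ks : \forall k \near 0, ball p s (k + x).
    by have := near_s x px; rewrite (near_shift 0) /= subr0.
  apply: filterS2 kq ks => k kq pk.
  have kx := lip x (k + x) px pk; rewrite addrK in kx.
  set d := u (k + x) - u x in kx *.
  have hM : `|k + B *m d| <= M * `|k|.
    apply: le_trans (ler_normD _ _) _; rewrite mulrDl mul1r lerD2l -mulrA.
    by apply: le_trans (BK d) _; rewrite ler_pM2l.
  have hq : ball 0 q (k + B *m d).
    rewrite -ball_normE /= sub0r normrN; apply: le_lt_trans hM _.
    by rewrite mulrC -ltr_pdivlMr.
  have [_ gk] := Hu _ pk.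
  have := Hq _ hq.
  have -> : k + B *m d + G x = k + x + B *m u (k + x).
    by rewrite /G addrACA -mulmxDr /d subrK.
  rewrite gk gG subrr sub0r normrN linearD /= -NE.
  rewrite -[_ + _]opprK opprD -NL -mulmxN -mulmxDr normrN => Hd.
  rewrite distrC -/(`|L k - d|); set w := L k - d in Hd *.
  have := dgB _ pG w; rewrite -NE => Hw.
  have w1 : `|w| <= `|lmx (N x) *m w| + `|lmx (N x) *m w - w|.
    by have := ler_normB (lmx (N x) *m w) (lmx (N x) *m w - w); rewrite subKr.
  have w2 : `|w| <= 2 * `|lmx (N x) *m w| by lra.
  apply: le_trans w2 _; rewrite -ler_pdivlMl //; apply: le_trans Hd _.
  have -> : 2^-1 * (e * `|k|) = e / (2 * M) * (M * `|k|) by field; rewrite gt_eqF.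
  by rewrite ler_pM2l.
exists r, s, u; split; [exact: s0|exact: sr|exact: rU|exact: binj|move=> x px].
have [pG gG] := Hu x px; have UG := rU _ pG.
have [dux _] := du x px.
have duE y k : ball p s y ->
    'd u y k = - invmx (lmx (N y)) *m 'd g (G y) k.
  move=> py; case: (du y py) => _ E.
  exact: (congr1 (fun F : _ -> _ => F k) E).
have dgu y : ball p s y -> forall k, 'd g (G y) (k + B *m 'd u y k) = 0.
  move=> py k; rewrite [X in k + B *m X](duE y k py).
  by rewrite linearD /= -NE mulNmx mulmxN mulKVmx ?Nu // subrr.
split; [exact: pG|exact: gG|by move=> v pv gv; apply: guniq pv pG gv gG| |].
  exact: dux.
split; [exact: dgu|move=> k].
have dG : differentiable G x.
  apply: differentiableD => //.
  apply: (@differentiable_comp _ _ _ _ u (mulmx B)) => //.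
  exact/linear_differentiable/linear_cV_continuous.
have dgv v i : differentiable (fun y => 'd g (G y) v i 0) x.
  have dv : differentiable (fun y => 'd g (G y) v) x.
    apply: (@differentiable_comp _ _ _ _ G (fun z => 'd g z v)) => //.
    by apply: ((sg 2).2 v).1.
  by have [] := is_diff_coord i (differentiableP dv).
(* ['d u y k] solves the linear system with matrix N(y) and right-hand side - 'd g (G y) k, both
   differentiable in y. *)
apply: (@mulmx2_solve_differentiable _ _ (fun y => lmx (N y))
  (fun y => 'd u y k) (fun y => - 'd g (G y) k)).
- by move=> i j; under eq_fun do rewrite mxE; exact: dgv.
- by move=> i; under eq_fun do rewrite mxE; exact: differentiableN.
- exact: Nu.
apply: filterS (near_s x px) => y py.
by rewrite [X in _ *m X](duE y k py) mulNmx mulmxN mulKVmx // Nu.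
Qed.
End Implicit.

(** * Smooth maps and symmetry of second derivatives *)

Lemma Ck_ext (R : realType) (V W : normedModType R) k (U : set V) (f g : V -> W) :
  open U -> (forall x, U x -> f x = g x) -> Ck k U f -> Ck k U g.
Proof.
move=> oU; elim: k f g => [|k IH] f g fg.
  move=> cf x Ux; have Un : \forall y \near x, U y by exact: open_nbhs_nbhs.
  rewrite /prop_for /continuous_at -(fg x Ux).
  apply: cvg_trans (cf x Ux); apply: near_eq_cvg.
  by apply: filterS Un => y; exact: fg.
have fgn x : U x -> {near x, f =1 g}.
  by move=> Ux; apply: filterS (open_nbhs_nbhs (conj oU Ux)) => y; exact: fg.
move=> [df cf]; split=> [x Ux|v].
  exact: near_eq_differentiable (fgn x Ux) (df x Ux).
apply: IH (cf v) => x Ux.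
have [_ E] := near_eq_is_diff (fgn x Ux) (differentiableP (df x Ux)).
by rewrite E.
Qed.

Lemma Ck_cst (R : realType) (V W : normedModType R) k (U : set V) (c : W) :
  Ck k U (fun=> c).
Proof.
elim: k c => [|k IH] c; first by move=> x _; exact: cst_continuous.
split=> [x _|v]; first exact: differentiable_cst.
have -> : (fun x => 'd (fun=> c) x v) = (fun=> 0).
  by apply/funext => x; rewrite diff_cst.
exact: IH.
Qed.

Lemma Ck_linear (R : realType) (V W : normedModType R) k (U : set V)
    (L : {linear V -> W}) : continuous L -> Ck k U L.
Proof.
move=> cL; case: k => [|k]; first by move=> x _; exact: cL.
split=> [x _|v]; first exact: linear_differentiable.
have -> : (fun x => 'd L x v) = (fun=> L v) by apply/funext => x; rewrite diff_lin.
exact: Ck_cst.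
Qed.

Lemma CkD (R : realType) (V W : normedModType R) k (U : set V) (f g : V -> W) :
  open U -> Ck k U f -> Ck k U g -> Ck k U (fun x => f x + g x).
Proof.
move=> oU; elim: k f g => [|k IH] f g.
  by move=> cf cg x Ux; apply: continuousD; [exact: cf|exact: cg].
move=> [df cf] [dg cg]; split=> [x Ux|v].
  by apply: differentiableD; [exact: df|exact: dg].
apply: (Ck_ext oU _ (IH _ _ (cf v) (cg v))) => x Ux.
exact: esym (congr1 (fun F : V -> W => F v) (diffD (df x Ux) (dg x Ux))).
Qed.

Lemma is_diff_affine (R : realType) (V W : normedModType R)
    (L : {linear V -> W}) (b : W) x :
  continuous L -> is_diff x (fun y => L y + b) L.
Proof.
move=> cL; rewrite -[X in is_diff _ _ X]addr0.
have LL : is_diff x L L.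
  by apply: DiffDef; [exact: linear_differentiable|exact: diff_lin].
exact: is_diffD.
Qed.

(** For an affine inner map, the derivative of the composite along v is again such a composite, with
    ['d g _ (L v)] in place of g; the induction needs no product rule. *)
Lemma Ck_comp_affine (R : realType) (V V' W : normedModType R) k (U : set V')
    (L : {linear V -> V'}) (b : V') (g : V' -> W) :
  continuous L -> open U -> Ck k U g ->
  Ck k [set x | U (L x + b)] (fun x => g (L x + b)).
Proof.
move=> cL oU; have dA x := is_diff_affine b x cL.
have cA : continuous (fun x => L x + b).
  by move=> x; apply: differentiable_continuous; case: (dA x).
have oUA : open [set x | U (L x + b)] by move/continuousP: cA; exact.
elim: k g => [|k IH] g.
  move=> cg x Ux; apply: (@continuous_comp _ _ _ (fun x => L x + b) g).
    exact: cA.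
  exact: cg.
move=> [dg cg].
have dgA x : U (L x + b) ->
    is_diff x (fun x => g (L x + b)) ('d g (L x + b) \o L).
  by move=> Ux; exact: (is_diff_comp (dA x) (differentiableP (dg _ Ux))).
split=> [x Ux|v]; first by case: (dgA x Ux).
apply: (Ck_ext oUA _ (IH _ (cg (L v)))) => x Ux.
by case: (dgA x Ux) => _ ->.
Qed.

Lemma is_diff_linear_comp (R : realType) (V W W' : normedModType R)
    (L : {linear W -> W'}) (g dg : V -> W) x :
  continuous L -> is_diff x g dg -> is_diff x (fun y => L (g y)) (L \o dg).
Proof.
move=> cL dgx; apply: (is_diff_comp dgx).
by apply: DiffDef; [exact: linear_differentiable|exact: diff_lin].
Qed.

Lemma Ck_linear_comp (R : realType) (V W W' : normedModType R) k (U : set V)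
    (L : {linear W -> W'}) (g : V -> W) :
  continuous L -> open U -> Ck k U g -> Ck k U (fun x => L (g x)).
Proof.
move=> cL oU; elim: k g => [|k IH] g.
  by move=> cg x Ux; apply: (@continuous_comp _ _ _ g L); [exact: cg|exact: cL].
move=> [dg cg].
have dL x (Ux : U x) := is_diff_linear_comp cL (differentiableP (dg x Ux)).
split=> [x Ux|v]; first by case: (dL x Ux).
apply: (Ck_ext oU _ (IH _ (cg v))) => x Ux.
by case: (dL x Ux) => _ ->.
Qed.

Section Quadratic.
Variables (R : realType) (n : nat) (W : normedModType R).
Variable (b : 'cV[R]_n -> 'cV[R]_n -> W).
Hypotheses (bl : forall y, linear (b^~ y)) (br : forall x, linear (b x)).

Let Bl y : {linear 'cV[R]_n -> W} :=
  HB.pack (b^~ y) (GRing.isLinear.Build _ _ _ _ _ (bl y)).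
Let Br x : {linear 'cV[R]_n -> W} :=
  HB.pack (b x) (GRing.isLinear.Build _ _ _ _ _ (br x)).

Lemma is_diff_quadratic x :
  is_diff x (fun y => b y y) (fun v => b x v + b v x).
Proof.
pose L : {linear 'cV[R]_n -> W} := Br x \+ Bl x.
apply: (@eps_is_diff _ _ _ _ _ L); first exact: linear_cV_continuous.
move=> e e0.
pose c := \sum_i \sum_j `|b (delta_mx i 0) (delta_mx j 0)|.
have c0 : 0 <= c by apply: sumr_ge0 => i _; exact: sumr_ge0.
have bc h : `|b h h| <= n%:R * (n%:R * c * `|h|) * `|h|.
  apply: (linear_cV_norm (L := Bl h)); first by rewrite !mulr_ge0.
  move=> i; apply: (linear_cV_norm (L := Br (delta_mx i 0))) => // j.
  rewrite /c /= (bigD1 i) //= (bigD1 j) //= -addrA lerDl.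
  by rewrite addr_ge0 // sumr_ge0 // => k _; exact: sumr_ge0.
(* |b h h| is at most n^2 c |h|^2; the added 1 keeps M positive when n or c vanishes. *)
pose M := n%:R * (n%:R * c) + 1.
have M0 : 0 < M by rewrite ltr_wpDl // !mulr_ge0.
have : \forall h \near (0 : 'cV[R]_n), `|h| < e / M.
  apply/nbhs_ballP; exists (e / M); first by rewrite /= divr_gt0.
  by move=> h; rewrite -ball_normE /= sub0r normrN.
apply: filterS => h hM.
have -> : b (h + x) (h + x) - b x x - L h = b h h.
  have E1 : b (h + x) (h + x) = b (h + x) h + b (h + x) x.
    exact: (linearD (Br (h + x))).
  have E2 y : b (h + x) y = b h y + b x y by exact: (linearD (Bl y)).
  rewrite E1 !E2 /L /=.
  by rewrite addrA addrK opprD addrA addrAC addrK addrK.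
apply: le_trans (bc h) _; rewrite ler_wpM2r //.
rewrite mulrA; apply: le_trans (_ : _ <= M * `|h|) _.
  by rewrite ler_wpM2r // lerDl.
by rewrite -ler_pdivlMl // mulrC ltW.
Qed.

Lemma smooth_quadratic : smooth_on setT (fun x => b x x).
Proof.
case=> [|k].
  move=> x _; apply: differentiable_continuous.
  by case: (is_diff_quadratic x).
split=> [x _|v]; first by case: (is_diff_quadratic x).
pose L : {linear 'cV[R]_n -> W} := Br v \+ Bl v.
have -> : (fun x => 'd (fun y => b y y) x v) = L.
  apply/funext => x; case: (is_diff_quadratic x) => _ ->.
  by rewrite /L /= addrC.
by apply: Ck_linear; exact: linear_cV_continuous.
Qed.
End Quadratic.

(** Here p1, p2 and p0 stand for ['d f _ u] at a + s c u + s v, at a + s c u and at a; X and Y are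
    the derivatives of ['d f _ u] at a along v and along s c u. Subtracting the two first-order
    expansions at a cancels Y. *)
Lemma second_difference_aux (R : realFieldType) (s e n X Y p0 p1 p2 m1 m2 : R) :
  0 < s -> 0 < e -> `|p1 - p0 - (Y + s * X)| <= e * m1 ->
  `|p2 - p0 - Y| <= e * m2 -> m1 <= s * n -> m2 <= s * n ->
  `|s * (p1 - p2) - s ^+ 2 * X| <= e * s ^+ 2 * (2 * n).
Proof.
move=> s0 e0 H1 H2 m1n m2n.
have -> : s * (p1 - p2) - s ^+ 2 * X =
    s * ((p1 - p0 - (Y + s * X)) - (p2 - p0 - Y)) by ring.
have -> : e * s ^+ 2 * (2 * n) = s * (e * (s * n) + e * (s * n)) by ring.
rewrite normrM gtr0_norm // ler_pM2l //; apply: le_trans (ler_normB _ _) _.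
by apply: lerD; [apply: le_trans H1 _|apply: le_trans H2 _]; rewrite ler_pM2l.
Qed.

(** * Symmetry of second derivatives at a point *)

Section Schwarz.
Variables (R : realType) (V : normedModType R) (f : V -> R) (a : V).
Hypothesis (df : \forall x \near a, differentiable f x).

(** The mean value theorem for x |-> f (x + s v) - f x along s u expresses the second difference by
    first derivatives near a. Hence differentiability of ['d f _ u] at the single point a is
    enough. *)
Lemma second_difference (u v : V) (e : R) : 0 < e ->
  differentiable (fun x => 'd f x u) a ->
  exists2 d, 0 < d & forall s, 0 < s -> s * (`|u| + `|v|) < d ->
    `|f (a + s *: u + s *: v) - f (a + s *: u) - f (a + s *: v) + f a -
      s ^+ 2 * 'd (fun x => 'd f x u) a v| <=
    e * s ^+ 2 * (2 * (`|u| + `|v|)).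
Proof.
move=> e0 du.
have /nbhs_ballP[d1 /= d10 H1] := diff_eps du e0.
have /nbhs_ballP[d2 /= d20 H2] := df.
exists (Num.min d1 d2); first by rewrite lt_min d10 d20.
move=> s s0; rewrite lt_min => /andP[sd1 sd2].
have nb c : 0 <= c <= 1 -> `|(s * c) *: u| <= s * `|u|.
  move=> /andP[c0 c1]; rewrite normrZ normrM !ger0_norm ?(ltW s0) //.
  by rewrite ler_wpM2r // ler_piMr // ltW.
have nsv : `|s *: v| = s * `|v| by rewrite normrZ gtr0_norm.
have nb1 c : 0 <= c <= 1 -> `|(s * c) *: u| <= s * (`|u| + `|v|).
  by move=> /nb H; apply: le_trans H _; rewrite ler_pM2l // lerDl.
have nb2 c : 0 <= c <= 1 -> `|(s * c) *: u + s *: v| <= s * (`|u| + `|v|).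
  move=> /nb H; apply: le_trans (ler_normD _ _) _.
  by rewrite mulrDr nsv lerD2r.
have D1 c : 0 <= c <= 1 -> differentiable f (a + c *: (s *: u)).
  move=> c01; apply: H2; rewrite -ball_normE /= opprD addrA subrr sub0r normrN.
  by rewrite scalerA mulrC; exact: le_lt_trans (nb1 _ c01) _.
have D2 c : 0 <= c <= 1 -> differentiable f (a + c *: (s *: u) + s *: v).
  move=> c01; apply: H2; rewrite -ball_normE /= -addrA opprD addrA subrr sub0r.
  by rewrite normrN scalerA [c * s]mulrC; exact: le_lt_trans (nb2 _ c01) _.
have D2' c : 0 <= c <= 1 ->
    is_diff (a + c *: (s *: u)) (fun x => f (x + s *: v) - f x)
      (fun w => 'd f (a + c *: (s *: u) + s *: v) w - 'd f (a + c *: (s *: u)) w).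
  move=> c01.
  have sh : is_diff (a + c *: (s *: u)) (fun x => x + s *: v) id.
    by rewrite -[X in is_diff _ _ X]addr0; exact: is_diffD.
  have := is_diff_comp sh (differentiableP (D2 c c01)).
  move=> dsh; exact: (is_diffB dsh (differentiableP (D1 c c01))).
have [|c /andP[c0 c1] E] :=
  @line_MVT R V (fun x => f (x + s *: v) - f x) a (s *: u).
  by move=> t t01; case: (D2' t t01).
have c01 : 0 <= c <= 1 by rewrite !ltW.
case: (D2' c c01) => _ dE.
have {}E : f (a + s *: u + s *: v) - f (a + s *: u) - f (a + s *: v) + f a =
    s * ('d f (a + c *: (s *: u) + s *: v) u - 'd f (a + c *: (s *: u)) u).
  transitivity (f (a + s *: u + s *: v) - f (a + s *: u) - (f (a + s *: v) - f a)).
    by ring.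
  have lz (L : {linear V -> R}) : L (s *: u) = s * L u by rewrite linearZ.
  by rewrite E dE !lz -mulrBr.
rewrite E.
have B1 : ball 0 d1 ((s * c) *: u + s *: v).
  by rewrite -ball_normE /= sub0r normrN; exact: le_lt_trans (nb2 _ c01) _.
have B2 : ball 0 d1 ((s * c) *: u).
  by rewrite -ball_normE /= sub0r normrN; exact: le_lt_trans (nb1 _ c01) _.
have key h : ball 0 d1 h ->
    `|'d f (a + h) u - 'd f a u - 'd (fun x => 'd f x u) a h| <= e * `|h|.
  by move=> /H1; rewrite [h + a]addrC.
have lz : 'd (fun x => 'd f x u) a ((s * c) *: u + s *: v) =
    'd (fun x => 'd f x u) a ((s * c) *: u) + s * 'd (fun x => 'd f x u) a v.
  by rewrite linearD [X in _ + X]linearZ.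
have K1 := key _ B1; have K2 := key _ B2.
rewrite lz addrA in K1; rewrite scalerA [c * s]mulrC.
exact: (second_difference_aux s0 e0 K1 K2 (nb2 _ c01) (nb1 _ c01)).
Qed.

Lemma second_diff_sym (u v : V) :
  differentiable (fun x => 'd f x u) a -> differentiable (fun x => 'd f x v) a ->
  'd (fun x => 'd f x u) a v = 'd (fun x => 'd f x v) a u.
Proof.
move=> du dv; set X := LHS; set Y := RHS.
apply/eqP; rewrite -subr_eq0 -normr_eq0 eq_le normr_ge0 andbT.
apply/ler_addgt0Pr => e e0; rewrite add0r.
pose M := `|u| + `|v| + 1; have M0 : 0 < M by rewrite ltr_wpDl // addr_ge0.
(* The two second differences each cost 2 e' s^2 (|u| + |v|) with e' = e / (4 M), so their sum is at
   most s^2 e. *)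
have e'0 : 0 < e / (4 * M) by rewrite divr_gt0 // mulr_gt0.
have [d1 d10 H1] := second_difference v e'0 du.
have [d2 d20 H2] := second_difference u e'0 dv.
pose s := Num.min d1 d2 / M.
have s0 : 0 < s by rewrite divr_gt0 // lt_min d10 d20.
have sd : s * (`|u| + `|v|) < Num.min d1 d2.
  rewrite /s mulrAC ltr_pdivrMr // ltr_pM2l ?lt_min ?d10 ?d20 //.
  by rewrite ltrDl.
have sd1 : s * (`|u| + `|v|) < d1.
  by apply: lt_le_trans sd _; rewrite ge_min lexx.
have sd2 : s * (`|v| + `|u|) < d2.
  by rewrite [`|v| + _]addrC; apply: lt_le_trans sd _; rewrite ge_min lexx orbT.
have {H1} := H1 s s0 sd1; have {H2} := H2 s s0 sd2.
rewrite -/X -/Y [a + s *: v + s *: u]addrAC [`|v| + _]addrC.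
set A := f (_ + _ + _); set A1 := f (a + s *: u); set A2 := f (a + s *: v).
move=> H2 H1.
have H : `|s ^+ 2 * (X - Y)| <= s ^+ 2 * e.
  have -> : s ^+ 2 * (X - Y) = (A - A2 - A1 + f a - s ^+ 2 * Y) -
     (A - A1 - A2 + f a - s ^+ 2 * X) by ring.
  apply: le_trans (ler_normB _ _) _; apply: le_trans (lerD H2 H1) _.
  have -> : e / (4 * M) * s ^+ 2 * (2 * (`|u| + `|v|)) +
      e / (4 * M) * s ^+ 2 * (2 * (`|u| + `|v|)) =
    s ^+ 2 * (e * ((`|u| + `|v|) / M)) by field; rewrite gt_eqF.
  rewrite ler_pM2l ?exprn_gt0 // ler_piMr // ?ltW //.
  by rewrite ltr_pdivrMr // mul1r ltrDl.
by move: H; rewrite normrM gtr0_norm ?exprn_gt0 // ler_pM2l ?exprn_gt0.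
Qed.
End Schwarz.

(** * Tangent spaces and coordinates *)

Lemma linear_cancel (R : pzRingType) (V W : lmodType R) (f : {linear V -> W}) x y :
  f (x + y) = 0 -> f x = 0 -> f y = 0.
Proof. by move=> fxy fx; rewrite linearD fx add0r in fxy. Qed.

Lemma right_inverse (R : realType) n c (f : {linear 'cV[R]_n -> 'cV[R]_c}) :
  (forall w, exists v, f v = w) ->
  exists B : 'M[R]_(n, c), forall u : 'cV[R]_c, f (B *m u) = u.
Proof.
move=> /choice[v fv].
exists (\matrix_(i, j) v (delta_mx j 0) i 0) => u.
have -> : (\matrix_(i, j) v (delta_mx j 0) i 0) *m u =
    \sum_j u j 0 *: v (delta_mx j 0).
  apply/matrixP => i j; rewrite ord1 mxE summxE; apply: eq_bigr => k _.
  by rewrite !mxE mulrC.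
rewrite linear_sum [RHS]cV_sum_delta; apply: eq_bigr => j _.
by rewrite linearZ fv.
Qed.

(* Two local equations cut out the same set, so composing one of them with a
   parametrization of the zero set of the other gives 0. *)
Lemma tangentE (R : realType) n (N : set 'cV[R]_n) p U (g : 'cV[R]_n -> 'cV[R]_2) :
  N p -> local_equation N p U g -> tangent 2 N p = [set v | 'd g p v = 0].
Proof.
move=> Np lg; apply/seteqP; split=> v /=; last by move=> gv; exists U, g.
move=> [U' [g' [[oU' U'p sg' surj' NU'] g'v]]].
case: lg => [oU Up sg surj NU].
have g'p : g' p = 0.
  by have : (N `&` U') p by []; rewrite NU' => -[].
have [B dB] := right_inverse (surj' p U'p).
have [r [s [u [s0 sr rU inj Hu]]]] := implicit oU' U'p sg' g'p dB.
have ps : ball p s p by exact: ballxx.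
have [_ _ uniq du [dgu _]] := Hu p ps.
have up : u p = 0.
  symmetry; apply: uniq; rewrite mulmx0 addr0 //.
  exact: (sr _ ps).
pose G x := x + B *m u x.
(* v lies in the kernel of the derivative of g' at p, so u has derivative 0 along v and G moves
   along v to first order. As g vanishes on the image of G near p, the chain rule gives
   ['d g p v = 0]. *)
have uv0 : 'd u p v = 0.
  have Gp0 : p + B *m u p = p by rewrite up mulmx0 addr0.
  have H := dgu v; rewrite Gp0 in H.
  exact: inj (sr _ ps) _ (linear_cancel H g'v).
have dG : is_diff p G (fun k => k + B *m 'd u p k).
  apply: is_diffD; apply: (is_diff_linear_comp (L := mulmx B)).
    exact: linear_cV_continuous.
  exact: differentiableP.
have Gp : G p = p by rewrite /G up mulmx0 addr0.
have gG0 : \forall x \near p, 0 = g (G x).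
  have cG : {for p, continuous G} by apply: differentiable_continuous; case: dG.
  have nU : \forall x \near p, U (G x).
    by apply: cG; rewrite Gp; exact: open_nbhs_nbhs.
  have ns : \forall x \near p, ball p s x.
    by apply: open_nbhs_nbhs; split => //; exact: ball_open.
  apply: filterS2 nU ns => x UGx px.
  have [pG g'G _ _ _] := Hu x px.
  have : (N `&` U') (G x) by rewrite NU'; split => //; exact: rU.
  move=> [NG _].
  by have : (N `&` U) (G x) by []; rewrite NU => -[].
have dg : is_diff (G p) g ('d g p).
  by rewrite Gp; apply: differentiableP; exact: (sg 1).1.
have [_ E] := is_diff_comp dG dg.
have := near_eq_is_diff gG0 (is_diff_cst 0 p).
case=> _ E0.
have Ev : 'd (g \o G) p v = 'd g p (v + B *m 'd u p v).
  exact: (congr1 (fun F : _ -> _ => F v) E).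
have E0v : 'd (g \o G) p v = 0 by exact: (congr1 (fun F : _ -> _ => F v) E0).
have vE : v + B *m 'd u p v = v by rewrite uv0 mulmx0 addr0.
exact: etrans (congr1 ('d g p) (esym vE)) (etrans (esym Ev) E0v).
Qed.

Lemma local_equation_at (R : realType) n c (N : set 'cV[R]_n) p q U
    (g : 'cV[R]_n -> 'cV[R]_c) :
  local_equation N p U g -> U q -> local_equation N q U g.
Proof. by case. Qed.

Section Zcoord.
Variables (R : realType) (n : nat).
Implicit Types z w : 'cV[R]_n.*2.

Lemma zcoordD z w k : zcoord (z + w) k = zcoord z k + zcoord w k.
Proof. by rewrite /zcoord !mxE. Qed.

Lemma zcoordN z k : zcoord (- z) k = - zcoord z k.
Proof. by rewrite /zcoord !mxE. Qed.

Lemma zcoordZ a z k : zcoord (a *: z) k = a%:C * zcoord z k.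
Proof.
by rewrite /zcoord !mxE; apply/eqP; rewrite eq_complex /= !mul0r subr0 addr0 !eqxx.
Qed.

Lemma zcoord0 k : zcoord (0 : 'cV[R]_n.*2) k = 0.
Proof. by rewrite /zcoord !mxE. Qed.

Lemma ord_double_case (a : 'I_n.*2) : exists k : 'I_n, a = xidx k \/ a = yidx k.
Proof.
have hk : (a./2 < n)%N by rewrite ltn_half_double.
exists (Ordinal hk); case E : (odd a); [right|left]; apply/val_inj => /=.
  by rewrite -[LHS]odd_double_half E.
by rewrite -[LHS]odd_double_half E.
Qed.

Lemma zcoord_inj z w : (forall k, zcoord z k = zcoord w k) -> z = w.
Proof.
move=> H; apply/matrixP => i j; rewrite ord1.
by have [k [->|->]] := ord_double_case i; have [] := H k.
Qed.

Lemma zcoord_Jst z k : zcoord (Jst_mx R n *m z) k = 'i%C * zcoord z k.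
Proof.
have xE : (Jst_mx R n *m z) (xidx k) 0 = - z (yidx k) 0.
  rewrite mxE (bigD1 (yidx k)) //= big1 ?addr0.
    by rewrite mxE /= odd_double /= eqxx /= mulN1r.
  move=> l lk; rewrite mxE /= odd_double /=.
  case: ifP => [/andP[lo /eqP E]|_].
    by move: (congr1 odd E); rewrite odd_double /= (negbTE lo).
  by case: ifP => [/eqP E|]; [case/eqP: lk; exact/val_inj|rewrite mul0r].
have yE : (Jst_mx R n *m z) (yidx k) 0 = z (xidx k) 0.
  rewrite mxE (bigD1 (xidx k)) //= big1 ?addr0.
    by rewrite mxE /= odd_double /= eqxx /= mul1r.
  move=> l lk; rewrite mxE /= odd_double /=.
  case: ifP => [/andP[lo /eqP[E]]|_]; last by rewrite mul0r.
  by case/eqP: lk; apply/val_inj.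
rewrite /zcoord xE yE; apply/eqP; rewrite eq_complex /=.
by apply/andP; split; apply/eqP; ring.
Qed.

Lemma Jst_mx_sqr z : Jst_mx R n *m (Jst_mx R n *m z) = - z.
Proof.
apply: zcoord_inj => k; rewrite !zcoord_Jst zcoordN mulrA.
by rewrite -expr2 sqr_i mulN1r.
Qed.

End Zcoord.

(** * Splitting C^n into the horizontal part 'z and the vertical part z^n *)

Section Splitting.
Variables (R : realType) (m : nat).

Definition hidx (i : 'I_m.*2) : 'I_m.+1.*2 :=
  widen_ord (leq_trans (leqnSn _) (leqnSn _)) i.

Lemma vidx_subproof (i : 'I_2) : (m.*2 + i < m.+1.*2)%N.
Proof. by rewrite doubleS -[m.*2.+2]addn2 ltn_add2l. Qed.

Definition vidx (i : 'I_2) : 'I_m.+1.*2 := Ordinal (vidx_subproof i).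

(** Written as matrices, the projections have the inclusions as transposes, and continuity of all
    these maps comes from [linear_cV_continuous]. *)
Definition hproj : 'M[R]_(m.*2, m.+1.*2) := \matrix_(i, j) (hidx i == j)%:R.
Definition vproj : 'M[R]_(2, m.+1.*2) := \matrix_(i, j) (vidx i == j)%:R.

Lemma sum_pick n (a : 'I_n) (F : 'I_n -> R) : \sum_j (a == j)%:R * F j = F a.
Proof.
rewrite (bigD1 a) //= eqxx mul1r big1 ?addr0 // => j.
by rewrite eq_sym => /negbTE ->; rewrite mul0r.
Qed.

Lemma hprojE p (z : 'M[R]_(m.+1.*2, p)) i j : (hproj *m z) i j = z (hidx i) j.
Proof.
by rewrite mxE -[RHS](sum_pick _ (z^~ j)); apply: eq_bigr => k _; rewrite mxE.
Qed.

Lemma vprojE p (z : 'M[R]_(m.+1.*2, p)) i j : (vproj *m z) i j = z (vidx i) j.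
Proof.
by rewrite mxE -[RHS](sum_pick _ (z^~ j)); apply: eq_bigr => k _; rewrite mxE.
Qed.

Lemma fstzE z : fstz z = hproj *m z.
Proof. by apply/matrixP => i j; rewrite hprojE !mxE ord1. Qed.

Lemma hidx_neq_vidx i j : hidx i == vidx j = false.
Proof.
apply/negbTE/eqP => /(congr1 val) /= E.
by have := ltn_ord i; rewrite E ltnNge leq_addr.
Qed.

Lemma hidx_inj i j : (hidx i == hidx j) = (i == j).
Proof. by []. Qed.

Lemma vidx_inj i j : (vidx i == vidx j) = (i == j).
Proof. by rewrite -!val_eqE /= eqn_add2l. Qed.

Lemma hv_case (a : 'I_m.+1.*2) : (exists i, a = hidx i) \/ (exists i, a = vidx i).
Proof.
have [am|ma] := ltnP a m.*2; [left|right].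
  by exists (Ordinal am); apply/val_inj.
have h : (a - m.*2 < 2)%N by rewrite ltn_subLR // addn2 -doubleS.
by exists (Ordinal h); apply/val_inj; rewrite /= subnKC.
Qed.

Lemma hproj_tr : hproj *m hproj^T = 1%:M.
Proof. by apply/matrixP => i j; rewrite hprojE !mxE hidx_inj eq_sym. Qed.

Lemma vproj_tr : vproj *m vproj^T = 1%:M.
Proof. by apply/matrixP => i j; rewrite vprojE !mxE vidx_inj eq_sym. Qed.

Lemma hproj_vproj_tr : hproj *m vproj^T = 0.
Proof. by apply/matrixP => i j; rewrite hprojE !mxE eq_sym hidx_neq_vidx. Qed.

Lemma vproj_hproj_tr : vproj *m hproj^T = 0.
Proof. by apply/matrixP => i j; rewrite vprojE !mxE hidx_neq_vidx. Qed.

Lemma hv_inj (z w : 'cV[R]_m.+1.*2) :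
  hproj *m z = hproj *m w -> vproj *m z = vproj *m w -> z = w.
Proof.
move=> hE vE; apply/matrixP => a j.
have [[i ->]|[i ->]] := hv_case a; first by rewrite -!hprojE hE.
by rewrite -!vprojE vE.
Qed.

Definition join (w : 'cV[R]_m.*2) (u : 'cV[R]_2) : 'cV[R]_m.+1.*2 :=
  hproj^T *m w + vproj^T *m u.

Lemma hproj_join w u : hproj *m join w u = w.
Proof.
by rewrite mulmxDr !mulmxA hproj_tr hproj_vproj_tr mul1mx mul0mx addr0.
Qed.

Lemma vproj_join w u : vproj *m join w u = u.
Proof.
by rewrite mulmxDr !mulmxA vproj_tr vproj_hproj_tr mul1mx mul0mx add0r.
Qed.

Lemma joinK z : join (hproj *m z) (vproj *m z) = z.
Proof. by apply: hv_inj; rewrite ?hproj_join ?vproj_join. Qed.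

Lemma zcoord_hproj (z : 'cV[R]_m.+1.*2) k :
  zcoord (hproj *m z) k = zcoord z (widen_ord (leqnSn m) k).
Proof.
by rewrite /zcoord !hprojE; congr (z _ _ +i* z _ _); exact/val_inj.
Qed.

Definition toC (u : 'cV[R]_2) : R[i] := u 0 0 +i* u 1 0.

Lemma lastzE z : lastz z = toC (vproj *m z).
Proof.
rewrite /lastz /zcoord /toC !vprojE; congr (z _ _ +i* z _ _).
  by apply/val_inj; rewrite /= addn0.
by apply/val_inj; rewrite /= addn1.
Qed.

End Splitting.

Arguments hproj {R m}.
Arguments vproj {R m}.

Lemma toCE (R : realType) (u : 'cV[R]_1.*2) : toC u = zcoord u ord0.
Proof. by rewrite /toC /zcoord; congr (u _ _ +i* u _ _); exact/val_inj. Qed.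

(** * The forms attached to a model structure *)

Local Arguments zcoord : simpl never.
Local Arguments conjc : simpl never.

Section ComplexPlane.
Variable R : realType.
Implicit Types u v : 'cV[R]_2.

Definition ofC (c : R[i]) : 'cV[R]_2 :=
  \col_i (if i == 0 then complex.Re c else complex.Im c).

Lemma ofCK c : toC (ofC c) = c.
Proof. by rewrite /toC !mxE /=; case: c. Qed.

Lemma toC_inj u v : toC u = toC v -> u = v.
Proof.
move=> [E0 E1]; apply/matrixP => i j; rewrite ord1.
have [->|->//] : i = 0 \/ i = 1.
  by case: i => [[|[|//]] hi]; [left|right]; exact/val_inj.
exact: E0.
Qed.

Lemma toCD u v : toC (u + v) = toC u + toC v.
Proof. by rewrite /toC !mxE. Qed.

Lemma toCN u : toC (- u) = - toC u.
Proof. by rewrite /toC !mxE. Qed.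

Lemma toCB u v : toC (u - v) = toC u - toC v.
Proof. by rewrite toCD toCN. Qed.

Lemma toCZ a u : toC (a *: u) = a%:C * toC u.
Proof. by rewrite !toCE zcoordZ. Qed.

Lemma toC0 : toC (0 : 'cV[R]_2) = 0.
Proof. by rewrite /toC !mxE. Qed.

Lemma toC_Jst u : toC (Jst_mx R 1 *m u) = 'i%C * toC u.
Proof. by rewrite !toCE zcoord_Jst. Qed.

Lemma ofC_linear (V : lmodType R) (h : V -> R[i]) :
  (forall a x y, h (a *: x + y) = a%:C * h x + h y) ->
  linear (fun x => ofC (h x)).
Proof.
by move=> hl a x y; apply: toC_inj; rewrite toCD toCZ !ofCK hl.
Qed.

End ComplexPlane.

Section Zdelta.
Variables (R : realType) (n : nat).

Lemma zcoord_sum (I : finType) (F : I -> 'cV[R]_n.*2) k :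
  zcoord (\sum_i F i) k = \sum_i zcoord (F i) k.
Proof.
by elim/big_rec2: _ => [|i a b _ <-]; rewrite ?zcoord0 ?zcoordD.
Qed.

Lemma xidx_eq (j k : 'I_n) : (xidx j == xidx k) = (j == k).
Proof. by rewrite -!val_eqE /= -!muln2 eqn_pmul2r. Qed.

Lemma yidx_eq (j k : 'I_n) : (yidx j == yidx k) = (j == k).
Proof. by rewrite -!val_eqE /= eqSS -!muln2 eqn_pmul2r. Qed.

Lemma xyidx_eq (j k : 'I_n) : (xidx j == yidx k) = false.
Proof.
by apply/negP => /eqP/(congr1 (odd \o val)); rewrite /= !odd_double.
Qed.

Lemma zcoord_delta_x j k :
  zcoord (delta_mx (xidx k) 0 : 'cV[R]_n.*2) j = (j == k)%:R.
Proof.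
rewrite /zcoord !mxE xidx_eq eq_sym [yidx j == _]eq_sym xyidx_eq /= andbT.
by rewrite eq_sym; case: (j == k).
Qed.

Lemma zcoord_delta_y j k :
  zcoord (delta_mx (yidx k) 0 : 'cV[R]_n.*2) j = (j == k)%:R * 'i%C.
Proof.
rewrite /zcoord !mxE yidx_eq xyidx_eq /= andbT.
by case: (j == k); rewrite ?mul1r ?mul0r.
Qed.

Lemma zcoord_sum_delta (z : 'cV[R]_n.*2) :
  z = \sum_k (z (xidx k) 0 *: delta_mx (xidx k) 0
              + z (yidx k) 0 *: delta_mx (yidx k) 0).
Proof.
apply: zcoord_inj => j; rewrite zcoord_sum.
under eq_bigr do rewrite zcoordD !zcoordZ zcoord_delta_x zcoord_delta_y.
rewrite (bigD1 j) //= big1 ?addr0 => [|k /negbTE kj]; last first.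
  by rewrite eq_sym kj mul0r !mulr0 addr0.
by rewrite eqxx mul1r mulr1 /zcoord; apply/eqP; rewrite eq_complex /=;
   apply/andP; split; apply/eqP; ring.
Qed.

End Zdelta.

Section Forms.
Variables (R : realType) (m : nat) (alpha beta : 'I_m -> 'I_m -> R[i]).
Implicit Types v w x y : 'cV[R]_m.*2.

(** [formA] and [formB] are the parts of sum_j conj(x^j) Ltilde_j(y, conj y) that are complex linear
    and conjugate linear in y; both are conjugate linear in x. *)
Definition formA x y : R[i] :=
  \sum_j \sum_l conjc (zcoord x j) * (alpha j l * zcoord y l).
Definition formB x y : R[i] :=
  \sum_j \sum_l conjc (zcoord x j) * (beta j l * conjc (zcoord y l)).

(* The z^n-component of [(J - J_st) v] at a point over [w], for [v] over C^m. *)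
Definition Lam w v : R[i] :=
  \sum_k conjc (zcoord v k) * Ltilde_fun alpha beta k w.

Lemma LamE w v : Lam w v = formA v w + formB v w.
Proof.
rewrite /Lam /formA /formB -big_split; apply: eq_bigr => k _.
rewrite /Ltilde_fun /Ltilde mulr_sumr -big_split; apply: eq_bigr => l _.
by rewrite mulrDr.
Qed.

Lemma conjcD (c d : R[i]) : conjc (c + d) = conjc c + conjc d.
Proof. exact: rmorphD. Qed.

Lemma conjcZ (a : R) (c : R[i]) : conjc (a%:C * c) = a%:C * conjc c.
Proof.
case: c => x y; rewrite /conjc.
by apply/eqP; rewrite eq_complex /=; apply/andP; split; apply/eqP; ring.
Qed.

Lemma conjcIM (c : R[i]) : conjc ('i%C * c) = - 'i%C * conjc c.
Proof.
case: c => x y; rewrite /conjc.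
by apply/eqP; rewrite eq_complex /=; apply/andP; split; apply/eqP; ring.
Qed.

Lemma formA_linl y a x x' : formA (a *: x + x') y = a%:C * formA x y + formA x' y.
Proof.
rewrite /formA mulr_sumr -big_split; apply: eq_bigr => j _.
rewrite mulr_sumr -big_split /=; apply: eq_bigr => l _.
by rewrite zcoordD zcoordZ conjcD conjcZ; ring.
Qed.

Lemma formA_linr x a y y' : formA x (a *: y + y') = a%:C * formA x y + formA x y'.
Proof.
rewrite /formA mulr_sumr -big_split; apply: eq_bigr => j _.
rewrite mulr_sumr -big_split /=; apply: eq_bigr => l _.
by rewrite zcoordD zcoordZ; ring.
Qed.

Lemma formB_linl y a x x' : formB (a *: x + x') y = a%:C * formB x y + formB x' y.
Proof.
rewrite /formB mulr_sumr -big_split; apply: eq_bigr => j _.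
rewrite mulr_sumr -big_split /=; apply: eq_bigr => l _.
by rewrite zcoordD zcoordZ conjcD conjcZ; ring.
Qed.

Lemma formB_linr x a y y' : formB x (a *: y + y') = a%:C * formB x y + formB x y'.
Proof.
rewrite /formB mulr_sumr -big_split; apply: eq_bigr => j _.
rewrite mulr_sumr -big_split /=; apply: eq_bigr => l _.
by rewrite zcoordD zcoordZ conjcD conjcZ; ring.
Qed.

Lemma formA_Jl x y : formA (Jst_mx R m *m x) y = - 'i%C * formA x y.
Proof.
rewrite /formA mulr_sumr; apply: eq_bigr => j _.
by rewrite mulr_sumr; apply: eq_bigr => l _; rewrite zcoord_Jst conjcIM; ring.
Qed.

Lemma formA_Jr x y : formA x (Jst_mx R m *m y) = 'i%C * formA x y.
Proof.
rewrite /formA mulr_sumr; apply: eq_bigr => j _.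
by rewrite mulr_sumr; apply: eq_bigr => l _; rewrite zcoord_Jst; ring.
Qed.

Lemma formB_Jl x y : formB (Jst_mx R m *m x) y = - 'i%C * formB x y.
Proof.
rewrite /formB mulr_sumr; apply: eq_bigr => j _.
by rewrite mulr_sumr; apply: eq_bigr => l _; rewrite zcoord_Jst conjcIM; ring.
Qed.

Lemma formB_Jr x y : formB x (Jst_mx R m *m y) = - 'i%C * formB x y.
Proof.
rewrite /formB mulr_sumr; apply: eq_bigr => j _.
by rewrite mulr_sumr; apply: eq_bigr => l _; rewrite zcoord_Jst conjcIM; ring.
Qed.

Lemma formB_sym : (forall j k, beta k j = beta j k) ->
  forall x y, formB x y = formB y x.
Proof.
move=> bs x y; rewrite /formB exchange_big; apply: eq_bigr => j _.
by apply: eq_bigr => l _; rewrite bs; ring.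
Qed.

Lemma formB_delta j k :
  formB (delta_mx (xidx j) 0) (delta_mx (xidx k) 0) = beta j k.
Proof.
rewrite /formB (bigD1 j) //= [X in _ + X]big1 ?addr0; last first.
  move=> i ij; rewrite big1 // => l _.
  by rewrite zcoord_delta_x (negbTE ij) conjc0 mul0r.
rewrite (bigD1 k) //= big1 ?addr0; last first.
  by move=> l lk; rewrite [zcoord _ l]zcoord_delta_x (negbTE lk) conjc0 !mulr0.
by rewrite !zcoord_delta_x !eqxx conjc1 mulr1 mul1r.
Qed.

(* The correction term of the normal form, polarized. *)
Definition corr2 x y : 'cV[R]_2 :=
  ofC ('i%C / 4 * (2 * formA x y + formB x y)).

Definition corr w := corr2 w w.

Lemma corr2_linl y : linear (corr2^~ y).
Proof. by apply: ofC_linear => a x x'; rewrite formA_linl formB_linl; ring. Qed.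

Lemma corr2_linr x : linear (corr2 x).
Proof. by apply: ofC_linear => a y y'; rewrite formA_linr formB_linr; ring. Qed.

Lemma is_diff_corr w : is_diff w corr (fun v => corr2 w v + corr2 v w).
Proof. exact: is_diff_quadratic corr2_linl corr2_linr w. Qed.

Lemma smooth_corr : smooth_on setT corr.
Proof. exact: smooth_quadratic corr2_linl corr2_linr. Qed.

Lemma toC_corr w : toC (corr w) =
  'i%C / 4 * (\sum_(j < m) conjc (zcoord w j) * Ltilde_fun alpha beta j w)
  + 'i%C / 4 * (\sum_(j < m) conjc (zcoord w j)
                * Ltilde alpha beta j (zcoord w) (fun=> 0)).
Proof.
rewrite ofCK -/(Lam w w) LamE.
have -> : \sum_(j < m) (zcoord w j)^* * Ltilde alpha beta j (zcoord w) (fun=> 0) =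
    formA w w.
  apply: eq_bigr => j _; rewrite /Ltilde mulr_sumr; apply: eq_bigr => l _.
  by rewrite mulr0 addr0.
by ring.
Qed.

(** Write A and B for the two forms. Passing from a term f(v) to f(J v) - i f(v) kills A(w, v) and
    multiplies by -2i both A(v, w) and B(w, v) + B(v, w), the latter being 2 B(v, w) by symmetry.
    The coefficients i/2 and i/4 in [corr2] turn the result into A(v, w) + B(v, w). *)
Lemma corr_dbar : (forall j k, beta k j = beta j k) -> forall w v,
  toC ('d corr w (Jst_mx R m *m v)) = 'i%C * toC ('d corr w v) + Lam w v.
Proof.
move=> bs w v.
have dE x : 'd corr w x = corr2 w x + corr2 x w.
  by case: (is_diff_corr w) => _ E; exact: (congr1 (fun F : _ -> _ => F x) E).
rewrite (dE v) (dE (_ *m _)) !toCD !ofCK formA_Jl formA_Jr formB_Jl formB_Jr LamE.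
rewrite (formB_sym bs w v).
have i2 : 'i%C * 'i%C = -1 :> R[i] by rewrite -expr2 sqr_i.
by field: i2.
Qed.

End Forms.

(** S(J u, J v) and S(J v, J u) are expanded by [SJ] in both slots. Apart from the symmetric term -
    S, the first is i (A(u, v) + A(v, u)) + i (B(u, v) - B(v, u)). The A part is symmetric in u and
    v and the B part antisymmetric, so the latter vanishes. *)
Lemma Lam_beta_sym (R : realType) (m : nat) (alpha beta : 'I_m -> 'I_m -> R[i])
    (S : 'cV[R]_m.*2 -> 'cV[R]_m.*2 -> R[i]) :
  (forall u v, S u v = S v u) ->
  (forall u v, S u (Jst_mx R m *m v) = 'i%C * S u v + Lam alpha beta u v) ->
  forall j k, beta k j = beta j k.
Proof.
move=> Ss SJ j k.
pose u : 'cV[R]_m.*2 := delta_mx (xidx j) 0.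
pose v : 'cV[R]_m.*2 := delta_mx (xidx k) 0.
have i2 : 'i%C * 'i%C = -1 :> R[i] by rewrite -expr2 sqr_i.
have H x y : S (Jst_mx R m *m x) (Jst_mx R m *m y) =
    - S y x + 'i%C * Lam alpha beta y x + Lam alpha beta (Jst_mx R m *m x) y.
  by rewrite SJ (Ss (_ *m _)) SJ mulrDr mulrA i2 mulN1r.
have := H u v; rewrite Ss H (Ss u v).
rewrite !LamE !formA_Jr !formB_Jr -!addrA => /addrI E.
have : (2 * 'i%C) * formB beta v u = (2 * 'i%C) * formB beta u v.
  apply/eqP; rewrite -subr_eq0; apply/eqP.
  by move/eqP: E; rewrite -subr_eq0 => /eqP E; rewrite -[RHS]E; ring.
have i0 : 2 * 'i%C != 0 :> R[i].
  by rewrite mulf_neq0 ?pnatr_eq0 // eq_complex /= oner_eq0 andbF.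
by move/(mulfI i0); rewrite !formB_delta.
Qed.

(** * The second derivative of a J-complex graph *)

Section GraphSymmetry.
Variables (R : realType) (m : nat) (alpha beta : 'I_m -> 'I_m -> R[i]).
Variables (W : set 'cV[R]_m.*2) (psi : 'cV[R]_m.*2 -> 'cV[R]_2) (w0 : 'cV[R]_m.*2).
Hypotheses (oW : open W) (Ww0 : W w0).
Hypothesis (dpsi : forall w, W w -> differentiable psi w).
Hypothesis (ddpsi : forall v, differentiable (fun w => 'd psi w v) w0).
Hypothesis (psiJ : forall w, W w -> forall v,
  toC ('d psi w (Jst_mx R m *m v)) = 'i%C * toC ('d psi w v) + Lam alpha beta w v).

Let D2 u v : 'cV[R]_2 := 'd (fun w => 'd psi w v) w0 u.

Let near_W : \forall w \near w0, W w.
Proof. exact: open_nbhs_nbhs. Qed.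

Lemma graph_D2_sym u v : D2 u v = D2 v u.
Proof.
have cE i w x : W w -> 'd (fun y => psi y i 0) w x = 'd psi w x i 0.
  move=> Ww; case: (is_diff_coord i (differentiableP (dpsi Ww))) => _ E.
  exact: (congr1 (fun F : _ -> _ => F x) E).
have dE i x y : differentiable (fun w => 'd (fun y => psi y i 0) w x) w0 /\
    'd (fun w => 'd (fun y => psi y i 0) w x) w0 y = D2 y x i 0.
  have nE : {near w0, (fun w => 'd psi w x i 0) =1
      (fun w => 'd (fun y => psi y i 0) w x)}.
    by apply: filterS near_W => w Ww; rewrite cE.
  case: (near_eq_is_diff nE (is_diff_coord i (differentiableP (ddpsi x)))) => d E.
  by split=> //; exact: (congr1 (fun F : _ -> _ => F y) E).
have df i : \forall w \near w0, differentiable (fun y => psi y i 0) w.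
  apply: filterS near_W => w Ww.
  by case: (is_diff_coord i (differentiableP (dpsi Ww))).
apply/matrixP => i j; rewrite ord1 -(dE i v u).2 -(dE i u v).2.
exact: second_diff_sym (df i) _ _ (dE i v u).1 (dE i u v).1.
Qed.

(** [psiJ] is differentiated in w along u; [Lam] is real linear in w, hence its own derivative. *)
Lemma graph_D2_J u v : toC (D2 u (Jst_mx R m *m v)) =
  'i%C * toC (D2 u v) + Lam alpha beta u v.
Proof.
have Ll : linear (fun w => ofC (Lam alpha beta w v)).
  by apply: ofC_linear => a x x'; rewrite !LamE formA_linr (formB_linr _ v); ring.
pose L : {linear 'cV[R]_m.*2 -> 'cV[R]_2} :=
  HB.pack (fun w => ofC (Lam alpha beta w v)) (GRing.isLinear.Build _ _ _ _ _ Ll).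
have dL : is_diff w0 L L.
  have cL := @linear_cV_continuous _ _ _ L.
  by apply: DiffDef; [exact: linear_differentiable|exact: diff_lin].
have dJ := is_diff_linear_comp (L := mulmx (Jst_mx R 1))
  (@linear_cV_continuous _ _ _ (mulmx (Jst_mx R 1))) (differentiableP (ddpsi v)).
have nE : {near w0, (fun w => mulmx (Jst_mx R 1) ('d psi w v)) + L =1
    (fun w => 'd psi w (Jst_mx R m *m v))}.
  apply: filterS near_W => w Ww; apply: toC_inj.
  by rewrite psiJ // toCD toC_Jst ofCK.
case: (near_eq_is_diff nE (is_diffD dJ dL)) => _ E.
have {}E : D2 u (Jst_mx R m *m v) = Jst_mx R 1 *m D2 u v + L u.
  exact: (congr1 (fun F : _ -> _ => F u) E).
by rewrite E toCD toC_Jst ofCK.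
Qed.

Lemma graph_beta_sym j k : beta k j = beta j k.
Proof.
apply: (Lam_beta_sym (S := fun u v => toC (D2 u v))) => u v.
  exact: congr1 (graph_D2_sym u v).
exact: graph_D2_J.
Qed.

End GraphSymmetry.

Section Compatible.
Variables (R : realType) (m : nat) (alpha beta : 'I_m -> 'I_m -> R[i]).

Lemma Ltilde_fun_linear k a w w' :
  Ltilde_fun alpha beta k (a *: w + w') =
  a%:C * Ltilde_fun alpha beta k w + Ltilde_fun alpha beta k w'.
Proof.
rewrite /Ltilde_fun /Ltilde mulr_sumr -big_split /=; apply: eq_bigr => l _.
by rewrite zcoordD zcoordZ conjcD conjcZ; ring.
Qed.

Lemma Ltilde_fun_delta_x k j :
  Ltilde_fun alpha beta k (delta_mx (xidx j) 0) = alpha k j + beta k j.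
Proof.
rewrite /Ltilde_fun /Ltilde (bigD1 j) //= big1 ?addr0 => [|l /negbTE lj].
  by rewrite !zcoord_delta_x eqxx conjc1 !mulr1.
by rewrite !zcoord_delta_x lj conjc0 !mulr0 addr0.
Qed.

Lemma Ltilde_fun_delta_y k j :
  Ltilde_fun alpha beta k (delta_mx (yidx j) 0) = 'i%C * (alpha k j - beta k j).
Proof.
rewrite /Ltilde_fun /Ltilde (bigD1 j) //= big1 ?addr0 => [|l /negbTE lj].
  rewrite !zcoord_delta_y eqxx -[1%:R * 'i%C]mulrC conjcIM conjc1; ring.
by rewrite !zcoord_delta_y lj mul0r conjc0 !mulr0 addr0.
Qed.

Lemma dbar_Ltilde j k w : dbar j (Ltilde_fun alpha beta k) w = beta k j.
Proof.
pose h u := Ltilde_fun alpha beta k u.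
have Rl : linear (fun u => complex.Re (h u) : R).
  by move=> a x y; rewrite /h Ltilde_fun_linear; case: (Ltilde_fun _ _ _ x) => ? ?;
     case: (Ltilde_fun _ _ _ y) => ? ? /=; rewrite mul0r subr0.
have Il : linear (fun u => complex.Im (h u) : R).
  by move=> a x y; rewrite /h Ltilde_fun_linear; case: (Ltilde_fun _ _ _ x) => ? ?;
     case: (Ltilde_fun _ _ _ y) => ? ? /=; rewrite mul0r addr0.
pose Lr : {linear 'cV[R]_m.*2 -> R} :=
  HB.pack (fun u => complex.Re (h u)) (GRing.isLinear.Build _ _ _ _ _ Rl).
pose Li : {linear 'cV[R]_m.*2 -> R} :=
  HB.pack (fun u => complex.Im (h u)) (GRing.isLinear.Build _ _ _ _ _ Il).
have DE (L : {linear 'cV[R]_m.*2 -> R}) v : 'D_v L w = L v.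
  have cL := @linear_cV_continuous _ _ _ L.
  by rewrite deriveE ?diff_lin //; exact: linear_differentiable.
have hE v : 'D_v Lr w +i* 'D_v Li w = h v.
  by rewrite !DE /Lr /Li /=; case: (h v).
rewrite /dbar (hE _) (hE _) /h Ltilde_fun_delta_x Ltilde_fun_delta_y.
have i2 : 'i%C * 'i%C = -1 :> R[i] by rewrite -expr2 sqr_i.
by field: i2.
Qed.

Lemma compatibleP : compatible alpha beta <-> forall j k, beta k j = beta j k.
Proof.
split=> [H j k|H j k w]; last by rewrite !dbar_Ltilde H.
by have := H j k 0; rewrite !dbar_Ltilde.
Qed.

End Compatible.

(** * The action of a model structure in the horizontal-vertical splitting *)

Section Model.
Variables (R : realType) (m : nat) (J : almost_complex_map R m.+1.*2).
Variables (alpha beta : 'I_m -> 'I_m -> R[i]).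
Hypotheses (hJ : model_structure J) (hL : associated_functions J alpha beta).

Lemma hproj_J (z v : 'cV[R]_m.+1.*2) :
  hproj *m (J z *m v) = Jst_mx R m *m (hproj *m v).
Proof.
have [L [JE L0 _ _ _]] := hJ.
have -> : hproj *m (J z *m v) = hproj *m (Jst_mx R m.+1 *m v).
  rewrite JE mulmxDl mulmxDr [X in _ + X](_ : _ = 0) ?addr0 //.
  apply/matrixP => i j; rewrite hprojE !mxE big1 // => c _.
  by rewrite L0 ?mul0r //= ltn_ord.
by apply: zcoord_inj => k; rewrite zcoord_Jst !zcoord_hproj zcoord_Jst.
Qed.

Lemma vproj_J_vert z u : toC (vproj *m (J z *m (vproj^T *m u))) = 'i%C * toC u.
Proof.
have [L [JE L0 L1 _ _]] := hJ.
have -> : J z *m (vproj^T *m u) = Jst_mx R m.+1 *m (vproj^T *m u).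
  suff LQ : L z *m (@vproj R m)^T = 0.
    by rewrite JE mulmxDl [X in _ + X]mulmxA LQ mul0mx addr0.
  apply/matrixP => a j; rewrite !mxE; apply: big1 => c _.
  rewrite !mxE; case: eqP => [<-|_]; last by rewrite mulr0.
  have [am|ma] := ltnP a m.*2; first by rewrite L0 ?mul0r.
  by rewrite L1 ?mul0r //= leq_addr.
rewrite -lastzE /lastz zcoord_Jst -/(lastz _) lastzE mulmxA vproj_tr mul1mx //.
Qed.

Lemma complexified_delta (A : 'M[R]_m.+1.*2) r c :
  (complexified A *m delta_mx c 0 : 'cV_m.+1.*2) r 0 = (A r c)%:C.
Proof. by rewrite -colE !mxE. Qed.

(** As 2 d/dzbar^k = d/dx^k + i d/dy^k, row r of the identity for d/dzbar^k determines J_{r,x} + i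
    J_{r,y}: it is Lk in the x^n row and - i Lk in the y^n row. Real and imaginary parts give the
    four entries. *)
Lemma J_entries z (k : 'I_m) (k' := widen_ord (leqnSn m) k) :
  let Lk := Ltilde_fun alpha beta k (fstz z) in
  [/\ J z (xidx ord_max) (xidx k') = complex.Re Lk,
      J z (xidx ord_max) (yidx k') = complex.Im Lk,
      J z (yidx ord_max) (xidx k') = complex.Im Lk
    & J z (yidx ord_max) (yidx k') = - complex.Re Lk].
Proof.
move=> Lk; have [H _] := hL z k; move: H; rewrite -/k' -/Lk => H.
have kmax : (ord_max == k') = false.
  by apply/negbTE; rewrite -val_eqE /= neq_ltn ltn_ord orbT.
have Hr r : (J z r (xidx k'))%:C + 'i%C * (J z r (yidx k'))%:C =
    2 * (- 'i%C *: dzbar_vec R k' + Lk *: dz_vec R ord_max) r 0.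
  rewrite -H /dzbar_vec -scalemxAr mulmxDr -scalemxAr [in RHS]mxE.
  rewrite [in RHS]mxE complexified_delta [X in _ * (_ * (_ + X))]mxE.
  rewrite complexified_delta.
  by rewrite mulrA mulfV ?mul1r // pnatr_eq0.
have := Hr (yidx ord_max); have := Hr (xidx ord_max).
rewrite !mxE /= !xidx_eq !yidx_eq !xyidx_eq.
rewrite ![yidx _ == xidx _]eq_sym !xyidx_eq kmax !eqxx /=.
have -> : 2 * (- 'i%C * (2^-1 * (0 + 'i%C * 0)) + Lk * (2^-1 * (1 - 'i%C * 0))) = Lk.
  by field.
have -> : 2 * (- 'i%C * (2^-1 * (0 + 'i%C * 0)) + Lk * (2^-1 * (0 - 'i%C * 1))) =
  - 'i%C * Lk by field.
case: Lk {H Hr} => a b /eqP; rewrite eq_complex /= => /andP[/eqP E1 /eqP E2].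
move=> /eqP; rewrite eq_complex /= => /andP[/eqP E3 /eqP E4].
by split; move: E1 E2 E3 E4; lra.
Qed.

Lemma vproj_J_horiz z w :
  toC (vproj *m (J z *m (hproj^T *m w))) = Lam alpha beta (fstz z) w.
Proof.
pose T (x : 'cV[R]_m.*2) := toC (vproj *m (J z *m (hproj^T *m x))).
have TD x y : T (x + y) = T x + T y by rewrite /T !mulmxDr toCD.
have TZ a x : T (a *: x) = a%:C * T x by rewrite /T -!scalemxAr toCZ.
have T0 : T 0 = 0 by rewrite /T !mulmx0 toC0.
have hdelta c : hproj^T *m (delta_mx c 0 : 'cV[R]_m.*2) = delta_mx (hidx c) 0.
  apply/matrixP => a j; rewrite -colE !mxE ord1 eqxx andbT.
  by rewrite eq_sym.
have Tdelta c : T (delta_mx c 0) =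
    J z (xidx ord_max) (hidx c) +i* J z (yidx ord_max) (hidx c).
  by rewrite /T hdelta -lastzE /lastz /zcoord -!colE !mxE.
rewrite -/(T w) {1}(zcoord_sum_delta w) (big_morph T TD T0) /Lam.
apply: eq_bigr => k _; rewrite TD !TZ !Tdelta.
have [E1 E2 E3 E4] := J_entries z k.
have -> : hidx (xidx k) = xidx (widen_ord (leqnSn m) k) by exact/val_inj.
have -> : hidx (yidx k) = yidx (widen_ord (leqnSn m) k) by exact/val_inj.
rewrite E1 E2 E3 E4 /zcoord /conjc; case: (Ltilde_fun _ _ _ _) => a b.
by apply/eqP; rewrite eq_complex /=; apply/andP; split; apply/eqP; ring.
Qed.

Lemma vproj_J z v : toC (vproj *m (J z *m v)) =
  'i%C * toC (vproj *m v) + Lam alpha beta (fstz z) (hproj *m v).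
Proof.
rewrite -{1}(joinK v) /join !mulmxDr toCD vproj_J_horiz vproj_J_vert.
by rewrite addrC.
Qed.

Lemma J_vert (z : 'cV[R]_m.+1.*2) (u : 'cV[R]_2) :
  J z *m (vproj^T *m u) = vproj^T *m (Jst_mx R 1 *m u).
Proof.
apply: hv_inj; first rewrite hproj_J.
  rewrite [hproj *m (vproj^T *m u)]mulmxA hproj_vproj_tr mul0mx mulmx0.
  by rewrite mulmxA hproj_vproj_tr mul0mx.
by apply: toC_inj; rewrite vproj_J_vert !mulmxA vproj_tr mul1mx toC_Jst.
Qed.

End Model.

(** * Normal forms of hypersurfaces *)

Lemma Ck_sub (R : realType) (V W : normedModType R) k (U U' : set V) (f : V -> W) :
  U' `<=` U -> Ck k U f -> Ck k U' f.
Proof.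
move=> U'U; elim: k f => [|k IH] f; first by move=> cf x /U'U; exact: cf.
by move=> [df cf]; split=> [x xU|v]; [exact: df _ (U'U _ xU)|exact: IH _ (cf v)].
Qed.

Lemma surj_of_inj (R : realType) n (f : {linear 'cV[R]_n -> 'cV[R]_2})
    (B : 'M[R]_(n, 2)) :
  (forall u : 'cV[R]_2, f (B *m u) = 0 -> u = 0) -> forall w, exists v, f v = w.
Proof.
move=> inj w; pose N : {linear 'cV[R]_2 -> 'cV[R]_2} := f \o mulmx B.
have Nu : lmx N \in unitmx by apply: inj_unitmx => v; rewrite mul_lmx; exact: inj.
exists (B *m (invmx (lmx N) *m w)).
by rewrite -[f _]/(N (invmx (lmx N) *m w)) -mul_lmx mulKVmx.
Qed.

Section Slice.
Variables (R : realType) (m : nat).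

Lemma is_diff_join (u0 : 'cV[R]_2) (w : 'cV[R]_m.*2) :
  is_diff w (fun w => join w u0) (mulmx (@hproj R m)^T).
Proof.
apply: (is_diff_affine (L := mulmx (@hproj R m)^T) (vproj^T *m u0) w).
exact: linear_cV_continuous.
Qed.

Lemma join_continuous (u0 : 'cV[R]_2) :
  continuous (fun w : 'cV[R]_m.*2 => join w u0).
Proof.
by move=> w; apply: differentiable_continuous; case: (is_diff_join u0 w).
Qed.

Lemma open_join (U : set 'cV[R]_m.+1.*2) (u0 : 'cV[R]_2) :
  open U -> open [set w : 'cV[R]_m.*2 | U (join w u0)].
Proof. by move=> oU; have /continuousP := @join_continuous u0; exact. Qed.

(** The norm is the maximum norm, so giving a point the vertical coordinates of the centre cannot
    increase its distance to the centre. *)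
Lemma ball_join (p q : 'cV[R]_m.+1.*2) r :
  ball p r q -> ball p r (join (hproj *m q) (vproj *m p)).
Proof.
rewrite -ball_normE /= => pq; apply: le_lt_trans pq; apply: cV_norm_le => // a.
have [[i ->]|[i ->]] := hv_case a.
  rewrite -hprojE mulmxBr hproj_join -mulmxBr hprojE; exact: cV_entry_norm.
by rewrite -vprojE mulmxBr vproj_join subrr mxE normr0.
Qed.

Lemma join_vert (p q : 'cV[R]_m.+1.*2) :
  q = join (hproj *m q) (vproj *m p) + vproj^T *m (vproj *m q - vproj *m p).
Proof.
by rewrite /join mulmxBr -addrA [X in _ = _ + X]addrC subrK -/(join _ _) joinK.
Qed.

Lemma linear_join (W : lmodType R) (f : {linear 'cV[R]_m.+1.*2 -> W}) w u :
  f (join w u) = f (hproj^T *m w) + f (vproj^T *m u).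
Proof. exact: linearD. Qed.

End Slice.

Section GraphGerm.
Variables (R : realType) (m : nat) (J : almost_complex_map R m.+1.*2).
Variables (alpha beta : 'I_m -> 'I_m -> R[i]).
Hypotheses (hJ : model_structure J) (hL : associated_functions J alpha beta).
Variables (U : set 'cV[R]_m.+1.*2) (g : 'cV[R]_m.+1.*2 -> 'cV[R]_2).
Variable p : 'cV[R]_m.+1.*2.
Hypotheses (oU : open U) (Up : U p) (sg : smooth_on U g) (gp : g p = 0).
Hypothesis (gv : forall u : 'cV[R]_2, 'd g p (vproj^T *m u) = 0 -> u = 0).
Hypothesis (gJ : forall q, U q -> g q = 0 -> forall v : 'cV[R]_m.+1.*2,
  'd g q v = 0 -> 'd g q (J q *m v) = 0).

(** The implicit function is taken in vertical directions and restricted to the horizontal slice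
    through p. The last clause, openness of transversality, later makes transversal points
    regular. *)
Lemma graph_lemma : exists (W : set 'cV[R]_m.*2) (psi : 'cV[R]_m.*2 -> 'cV[R]_2),
  [/\ open W, W (hproj *m p),
      forall w, W w ->
        [/\ differentiable psi w, forall v, differentiable (fun w => 'd psi w v) w
          & forall v, toC ('d psi w (Jst_mx R m *m v)) =
              'i%C * toC ('d psi w v) + Lam alpha beta w v],
      \forall q \near p, g q = 0 <-> vproj *m q = psi (hproj *m q)
    & \forall q \near p, forall u : 'cV[R]_2, 'd g q (vproj^T *m u) = 0 -> u = 0].
Proof.
pose Q : 'M[R]_(m.+1.*2, 2) := vproj^T.
pose N : {linear 'cV[R]_2 -> 'cV[R]_2} := 'd g p \o mulmx Q.
pose M := lmx N.
have Mu : M \in unitmx by apply: inj_unitmx => v; rewrite mul_lmx; exact: gv.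
(* Normalizing the vertical inclusion by the inverse of ['d g p] on vertical vectors makes it a
   right inverse of ['d g p]. *)
pose K := invmx M; pose B := Q *m K.
have QB (u : 'cV[R]_2) : Q *m u = B *m (M *m u) by rewrite /B -mulmxA mulKmx.
have dB u : 'd g p (B *m u) = u.
  rewrite /B -mulmxA -[LHS]/(N (K *m u)) -(mul_lmx N) -/M; exact: mulKVmx.
have [r [s [u [s0 sr rU inj Hu]]]] := implicit oU Up sg gp dB.
have injQ y : ball p r y -> forall v : 'cV[R]_2, 'd g y (Q *m v) = 0 -> v = 0.
  move=> py v; rewrite [X in 'd g y X = 0](QB v) => /(inj _ py) Mv.
  by rewrite -[v](mulKmx Mu) Mv mulmx0.
pose X w : 'cV[R]_m.+1.*2 := join w (vproj *m p).
pose psi w := vproj *m p + K *m u (X w).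
pose W := [set w | ball p s (X w)].
have GX w : X w + B *m u (X w) = join w (psi w).
  by rewrite /X /join /psi mulmxDr -addrA /B -mulmxA.
have oW : open W by apply: open_join; exact: ball_open.
have Wp : W (hproj *m p) by rewrite /W /X /= joinK; exact: ballxx.
have dX w : is_diff w X (mulmx (@hproj R m)^T) by exact: is_diff_join.
have dpsi w : W w ->
    is_diff w psi (fun v => K *m 'd u (X w) (hproj^T *m v)).
  move=> Ww; have [_ _ _ du _] := Hu _ Ww.
  have duX := is_diff_comp (dX w) (differentiableP du).
  have cK := @linear_cV_continuous _ _ _ (mulmx K).
  have dK := is_diff_linear_comp (L := mulmx K) cK duX.
  rewrite -[X in is_diff _ _ X]add0r; exact: is_diffD (is_diff_cst (vproj *m p) w) dK.
have dpsiE w v : W w -> 'd psi w v = K *m 'd u (X w) (hproj^T *m v).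
  move=> Ww; case: (dpsi w Ww) => _ E; exact: (congr1 (fun F : _ -> _ => F v) E).
exists W, psi; split=> //.
- move=> w Ww; have [pG gG _ _ [dgu ddu]] := Hu _ Ww.
  split.
  + by case: (dpsi w Ww).
  + move=> v.
    apply: (@near_eq_differentiable _ _ _
        (fun w => mulmx K ('d u (X w) (hproj^T *m v)))).
      have := open_nbhs_nbhs (conj oW Ww).
      by apply: filterS => w' Ww'; rewrite dpsiE.
    have dd := is_diff_comp (dX w) (differentiableP (ddu (hproj^T *m v))).
    have cK := @linear_cV_continuous _ _ _ (mulmx K).
    by case: (is_diff_linear_comp (L := mulmx K) cK dd).
  + have tang v : 'd g (join w (psi w)) (join v ('d psi w v)) = 0.
      have E := dgu (hproj^T *m v).
      have E1 : hproj^T *m v + B *m 'd u (X w) (hproj^T *m v) = join v ('d psi w v).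
        by rewrite (dpsiE _ _ Ww) /join /B -mulmxA.
      rewrite E1 GX in E; exact: E.
    move=> v; set q := join w (psi w).
    have Uq : U q by rewrite /q -GX; exact: rU.
    have gq : g q = 0 by rewrite /q -GX.
    have pq : ball p r q by rewrite /q -GX.
    (* J applied to (v, psi' v) and the vector (Jst v, psi' (Jst v)) are both tangent and have the
       same horizontal part. Their difference is a vertical tangent vector, hence 0 by
       transversality; equality of the vertical parts is the claim. *)
    have T1 := gJ Uq gq (tang v).
    have T2 := tang (Jst_mx R m *m v).
    set eta := vproj *m (J q *m join v ('d psi w v)).
    have JE : J q *m join v ('d psi w v) = join (Jst_mx R m *m v) eta.
      by apply: hv_inj; rewrite ?hproj_join ?vproj_join // (hproj_J hJ) hproj_join.
    rewrite JE in T1.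
    have T3 : 'd g q (Q *m (eta - 'd psi w (Jst_mx R m *m v))) = 0.
      have E3 : Q *m (eta - 'd psi w (Jst_mx R m *m v)) =
          join (Jst_mx R m *m v) eta -
          join (Jst_mx R m *m v) ('d psi w (Jst_mx R m *m v)).
        by rewrite /join opprD addrACA subrr add0r mulmxBr.
      rewrite E3; apply: etrans (linearB ('d g q) _ _) _.
      by apply/eqP; rewrite subr_eq0; apply/eqP; exact: etrans T1 (esym T2).
    have /eqP := injQ q pq _ T3; rewrite subr_eq0 => /eqP <-.
    rewrite /eta (vproj_J hJ hL) vproj_join hproj_join.
    by rewrite fstzE /q hproj_join.
- have nr : \forall q \near p, ball p s q by exact: nbhsx_ballx.
  apply: filterS nr => q pq.
  have Wq : ball p s (X (hproj *m q)) by exact: ball_join.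
  have [pG gG uniq _ _] := Hu _ Wq.
  have qE : q = X (hproj *m q) + B *m (M *m (vproj *m q - vproj *m p)).
    by rewrite -QB; exact: join_vert.
  split=> [gq|vq].
    have /(congr1 (mulmx K)) : M *m (vproj *m q - vproj *m p) = u (X (hproj *m q)).
      by apply: uniq; rewrite -qE //; exact: sr.
    by rewrite mulKmx // /psi => <-; rewrite addrC subrK.
  by rewrite -(joinK q) vq -GX.
- have nr : \forall q \near p, ball p s q by exact: nbhsx_ballx.
  by apply: filterS nr => q /sr; exact: injQ.
Qed.

End GraphGerm.

Lemma local_equationE (R : realType) n c (N : set 'cV[R]_n) p U
    (g : 'cV[R]_n -> 'cV[R]_c) q :
  local_equation N p U g -> U q -> N q <-> g q = 0.
Proof.
move=> [_ _ _ _ NU] Uq; split=> [Nq|gq].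
  by have : (N `&` U) q by []; rewrite NU => -[].
by have : [set q | U q /\ g q = 0] q by []; rewrite -NU => -[].
Qed.

Lemma hypersurface_J (R : realType) n (J : almost_complex_map R n) N p U
    (g : 'cV[R]_n -> 'cV[R]_2) :
  complex_hypersurface J N -> local_equation N p U g ->
  forall q, U q -> g q = 0 -> forall v, 'd g q v = 0 -> 'd g q (J q *m v) = 0.
Proof.
move=> [_ NJ] lg q Uq gq v gv.
have Nq : N q by apply/(local_equationE lg Uq).
have T := tangentE Nq (local_equation_at lg Uq).
have : tangent 2 N q (J q *m v).
  by rewrite -(NJ q Nq); exists v => //; rewrite T.
by rewrite T.
Qed.

Section Cylinder.
Variables (R : realType) (m : nat) (J : almost_complex_map R m.+1.*2).
Variables (alpha beta : 'I_m -> 'I_m -> R[i]).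
Hypotheses (hJ : model_structure J) (hL : associated_functions J alpha beta).
Variables (N : set 'cV[R]_m.+1.*2) (p : 'cV[R]_m.+1.*2).
Variables (U : set 'cV[R]_m.+1.*2) (g : 'cV[R]_m.+1.*2 -> 'cV[R]_2).
Hypotheses (hN : complex_hypersurface J N) (Np : N p).
Hypothesis (lg : local_equation N p U g).
Hypothesis (vert : \forall q \near p, N q ->
  forall u : 'cV[R]_2, 'd g q (vproj^T *m u) = 0).

(* A solution [u] of [g (x + B *m u x) = 0] with [B] horizontal is constant in
   the vertical directions, so the zero set of [u], which is N, is a cylinder. *)
Lemma cylinder_slice : exists (B : 'M[R]_(m.*2, 2)) (r : R),
  [/\ 0 < r, ball p r `<=` U,
      forall q, ball p r q -> N q -> forall u : 'cV[R]_2, 'd g q (vproj^T *m u) = 0,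
      forall q, ball p r q ->
        forall u : 'cV[R]_2, 'd g q (hproj^T *m (B *m u)) = 0 -> u = 0
    & forall q, ball p r q -> N q <-> N (join (hproj *m q) (vproj *m p))].
Proof.
have [oU Up sg surj _] := lg.
have gp : g p = 0 by apply/(local_equationE lg Up).
have vp := nbhs_singleton vert Np.
(* ['d g p] kills vertical vectors, so it is already onto when restricted to horizontal ones, and
   [B] can be chosen horizontal. *)
have hsurj w : exists v, ('d g p \o mulmx (@hproj R m)^T) v = w.
  have [v gv] := surj p Up w; exists (hproj *m v); rewrite -gv.
  apply: esym; rewrite -{1}(joinK v); apply: etrans (linear_join ('d g p) _ _) _.
  by rewrite [X in _ + X](vp (vproj *m v)) addr0.
have [B' dB'] := right_inverse hsurj.
pose B := hproj^T *m B'.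
have BE (u : 'cV[R]_2) : B *m u = hproj^T *m (B' *m u) by rewrite mulmxA.
have dB (u : 'cV[R]_2) : 'd g p (B *m u) = u.
  by rewrite [X in 'd g p X](BE u); exact: dB'.
have [r [s [u [s0 sr rU inj Hu]]]] := implicit oU Up sg gp dB.
pose G x := x + B *m u x.
have ps : ball p s p by exact: ballxx.
have up : u p = 0.
  have [_ _ uniq _ _] := Hu p ps; symmetry; apply: uniq.
    by rewrite mulmx0 addr0; exact: sr.
  by rewrite mulmx0 addr0.
pose S q := N q -> forall u : 'cV[R]_2, 'd g q (vproj^T *m u) = 0.
(* The derivative of u at x involves ['d g] at G x, so verticality is needed there; G is continuous
   at p and fixes p. *)
have nG : \forall x \near p, S (G x).
  have [_ _ _ du _] := Hu p ps.
  have dG : differentiable G p.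
    have cB := @linear_cV_continuous _ _ _ (mulmx B).
    case: (is_diffD (is_diff_id p)
      (is_diff_linear_comp (L := mulmx B) cB (differentiableP du))) => dG _.
    exact: dG.
  have cG := differentiable_continuous dG.
  have Gp : G p = p by rewrite /G up mulmx0 addr0.
  have nS : nbhs (G p) S by rewrite Gp.
  exact: cG S nS.
have ns : \forall x \near p, ball p s x by exact: nbhsx_ballx.
have nall : \forall x \near p, ball p s x /\ (S (G x) /\ S x).
  by apply: filterI ns _; apply: filterI nG vert.
have /nbhs_ballP[d /= d0 Hd] := nall.
have ds q : ball p d q -> ball p s q by move=> /Hd[].
have UE q : ball p s q -> N q <-> u q = 0.
  move=> pq; have [pG gG uniq _ _] := Hu q pq.
  have Uq : U q by apply: rU; exact: sr.
  split=> [/(local_equationE lg Uq) gq|uq].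
    by symmetry; apply: uniq; rewrite mulmx0 addr0 //; exact: sr.
  by apply/(local_equationE lg Uq); rewrite uq mulmx0 addr0 in gG.
have du0 q (e : 'cV[R]_2) : ball p d q -> 'd u q (vproj^T *m e) = 0.
  move=> /Hd[pq [vq _]]; have [pG gG _ _ [dgu _]] := Hu q pq.
  have NG : N (G q) by apply/(local_equationE lg (rU _ pG)).
  by apply: (inj _ pG); exact: linear_cancel (dgu _) (vq NG e).
have ucst q : ball p d q -> u q = u (join (hproj *m q) (vproj *m p)).
  move=> pq; set x := join _ _.
  have px : ball p d x by exact: ball_join.
  have seg t : 0 <= t <= 1 ->
      ball p d (x + t *: (vproj^T *m (vproj *m q - vproj *m p))).
    move=> t01; have -> : vproj^T *m (vproj *m q - vproj *m p) = q - x.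
      by rewrite {2}(join_vert p q) addrAC subrr add0r.
    by move: px pq; rewrite -ball_normE /= => px pq; exact: normB_segment.
  apply/matrixP => i j; rewrite ord1.
  have dui t : 0 <= t <= 1 ->
     is_diff (x + t *: (vproj^T *m (vproj *m q - vproj *m p)))
       (fun y => u y i 0)
       (fun v => 'd u (x + t *: (vproj^T *m (vproj *m q - vproj *m p))) v i 0).
    move=> /seg/ds ps'; have [_ _ _ du _] := Hu _ ps'.
    exact: is_diff_coord (differentiableP du).
  have [t t01|t /andP[t0 t1] E] := @line_MVT R _ (fun y => u y i 0) x
    (vproj^T *m (vproj *m q - vproj *m p)).
    by case: (dui t t01).
  have t01 : 0 <= t <= 1 by rewrite !ltW.
  rewrite -(join_vert p q) -/x in E.
  case: (dui t t01) => _ dE.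
  have E0 : u q i 0 - u x i 0 = 0.
    apply: etrans E _; apply: etrans (congr1 (fun F : _ -> _ => F _) dE) _.
    have := du0 _ (vproj *m q - vproj *m p) (seg t t01).
    by move=> /(congr1 (fun M : 'cV_2 => M i 0)) H; apply: etrans H _; rewrite mxE.
  by apply/eqP; rewrite -subr_eq0; apply/eqP.
exists B', d; split; [exact: d0| | | |].
- by move=> q /ds/sr/rU.
- by move=> q /Hd[_ []].
- move=> q pq u1; have pr : ball p r q by apply: sr; exact: ds.
  by rewrite -[X in 'd g q X = 0](BE u1); exact: inj _ pr _.
move=> q pq; have pj := ball_join pq.
by rewrite (UE _ (ds _ pq)) (UE _ (ds _ pj)) ucst.
Qed.

(** The base A is cut out by the slice of g through p, which is as smooth as g. For v tangent to A,
    J maps v to a tangent vector of N with horizontal part Jst v; its vertical part is itself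
    tangent by verticality, so Jst v is tangent to A. *)
Lemma cylinder_lemma : cylinder_germ N p.
Proof.
have [oU Up sg surj _] := lg.
have [B [r [r0 rU vr inj cyl]]] := cylinder_slice.
pose X w : 'cV[R]_m.+1.*2 := join w (vproj *m p).
pose WA := [set w | ball p r (X w)].
pose A := [set w | WA w /\ g (X w) = 0].
have oW : open WA by apply: open_join; exact: ball_open.
have dX w : is_diff w X (mulmx (@hproj R m)^T) by exact: is_diff_join.
pose h w := g (X w).
have dh w : WA w -> is_diff w h (fun v => 'd g (X w) (hproj^T *m v)).
  move=> Ww; have dg := differentiableP ((sg 1).1 _ (rU _ Ww)).
  exact: (is_diff_comp (dX w) dg).
have dhE w v : WA w -> 'd h w v = 'd g (X w) (hproj^T *m v).
  move=> Ww; case: (dh w Ww) => _ E; exact: (congr1 (fun F : _ -> _ => F v) E).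
have sh : smooth_on WA h.
  move=> k; have cP := @linear_cV_continuous _ _ _ (mulmx (@hproj R m)^T).
  have := Ck_comp_affine (L := mulmx (@hproj R m)^T) (vproj^T *m (vproj *m p))
    cP oU (sg k).
  by apply: Ck_sub => w Ww; exact: rU.
have lA w : A w -> local_equation A w WA h.
  move=> [Ww gw]; split=> //.
    move=> q Wq; apply: (surj_of_inj (f := 'd h q) (B := B)) => u E.
    apply: (inj _ Wq); apply: etrans E; exact: esym (dhE _ _ Wq).
  by apply/seteqP; split=> [q [[] //]|q [Wq hq]].
have tA w : A w -> tangent 2 A w = [set v | 'd h w v = 0].
  by move=> Aw; exact: tangentE Aw (lA w Aw).
have JA w : A w -> forall v, tangent 2 A w v -> tangent 2 A w (Jst_mx R m *m v).
  move=> Aw v; rewrite (tA w Aw) /= => hv.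
  have [Ww gw] := Aw; have UX := rU _ Ww.
  have NX : N (X w) by apply/(local_equationE lg UX).
  have gv : 'd g (X w) (hproj^T *m v) = 0 by exact: etrans (esym (dhE w v Ww)) hv.
  have := hypersurface_J hN lg UX gw gv.
  set eta := vproj *m (J (X w) *m (hproj^T *m v)).
  have JE : J (X w) *m (hproj^T *m v) = join (Jst_mx R m *m v) eta.
    apply: hv_inj; rewrite ?hproj_join ?vproj_join // (hproj_J hJ).
    by rewrite [hproj *m (_ *m v)]mulmxA hproj_tr mul1mx.
  rewrite JE => gJv; apply: etrans (dhE w _ Ww) _.
  have E : 'd g (X w) (vproj^T *m eta + hproj^T *m (Jst_mx R m *m v)) = 0.
    by rewrite addrC; exact: gJv.
  exact: linear_cancel E (vr _ Ww NX eta).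
exists A; split.
- split; first by move=> w Aw; exists WA, h; exact: lA.
  move=> w Aw; apply/seteqP; split=> [_ [v Tv <-]|v Tv]; first exact: JA.
  exists (- (Jst_mx R m *m v)); last by rewrite mulmxN Jst_mx_sqr opprK.
  have := JA w Aw v Tv; rewrite (tA w Aw) /= => H.
  apply: etrans (linearN ('d h w) _) _.
  by apply/eqP; rewrite oppr_eq0; apply/eqP; exact: H.
- rewrite fstzE; split; first by rewrite /WA /= /X joinK; exact: ballxx.
  by rewrite /X joinK; apply/(local_equationE lg Up).
have nr : \forall q \near p, ball p r q by exact: nbhsx_ballx.
apply: filterS nr => q pq; rewrite (cyl q pq) fstzE.
have pj := ball_join pq.
split=> [Nj|[_ gj]]; last by apply/(local_equationE lg (rU _ pj)).
by split=> //; apply/(local_equationE lg (rU _ pj)).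
Qed.

End Cylinder.

(** * Integrability *)

(** A complex linear [T] on R^2 = C is multiplication by T(1). *)
Lemma toC_linear_eq (R : realType) (T : 'cV[R]_2 -> R[i]) :
  (forall u v, T (u + v) = T u + T v) -> (forall a u, T (a *: u) = a%:C * T u) ->
  (forall u, T (Jst_mx R 1 *m u) = 'i%C * T u) ->
  forall u v, toC v * T u = toC u * T v.
Proof.
move=> TD TZ TJ; pose e : 'cV[R]_2 := ofC 1.
suff H u : T u = toC u * T e by move=> u v; rewrite (H u) (H v) mulrCA.
have uE : u = complex.Re (toC u) *: e + complex.Im (toC u) *: (Jst_mx R 1 *m e).
  apply: toC_inj; rewrite toCD !toCZ toC_Jst !ofCK.
  by case: (toC u) => a b; apply/eqP; rewrite eq_complex /=; apply/andP;
     split; apply/eqP; ring.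
rewrite {1}uE TD !TZ TJ; case: (toC u) => a b /=.
by rewrite mulrA -mulrDl; congr (_ * _); apply/eqP; rewrite eq_complex /=;
   apply/andP; split; apply/eqP; ring.
Qed.

Section JstSplit.
Variables (R : realType) (m : nat).

Lemma hproj_Jst (v : 'cV[R]_m.+1.*2) :
  hproj *m (Jst_mx R m.+1 *m v) = Jst_mx R m *m (hproj *m v).
Proof. by apply: zcoord_inj => k; rewrite zcoord_Jst !zcoord_hproj zcoord_Jst. Qed.

Lemma vproj_Jst (v : 'cV[R]_m.+1.*2) :
  toC (vproj *m (Jst_mx R m.+1 *m v)) = 'i%C * toC (vproj *m v).
Proof. by rewrite -!lastzE /lastz zcoord_Jst. Qed.

Definition coord_mx n (j : 'I_n) : 'M[R]_(2, n.*2) :=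
  \matrix_(i, c) ((if i == 0 then xidx j else yidx j) == c)%:R.

Lemma toC_coord_mx n (j : 'I_n) (v : 'cV[R]_n.*2) :
  toC (coord_mx j *m v) = zcoord v j.
Proof.
rewrite /toC /zcoord !mxE; congr (_ +i* _).
  rewrite -[RHS](sum_pick (xidx j) (fun c => v c 0)).
  by apply: eq_bigr => c _; rewrite mxE.
rewrite -[RHS](sum_pick (yidx j) (fun c => v c 0)).
by apply: eq_bigr => c _; rewrite mxE.
Qed.

End JstSplit.

Section GlobalChart.
Variables (R : realType) (m : nat) (J : almost_complex_map R m.+1.*2).
Variables (alpha beta : 'I_m -> 'I_m -> R[i]).
Hypotheses (hJ : model_structure J) (hL : associated_functions J alpha beta).
Hypothesis bs : forall j k, beta k j = beta j k.

(* [shear 1] and [shear (-1)] are mutually inverse, and [shear (-1)] is the map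
   z |-> ('z, z^n - corr 'z). *)
Definition shear (a : R) (z : 'cV[R]_m.+1.*2) : 'cV[R]_m.+1.*2 :=
  z + (a *: vproj^T) *m corr alpha beta (hproj *m z).

Lemma hproj_shear a z : hproj *m shear a z = hproj *m z.
Proof.
by rewrite mulmxDr mulmxA -scalemxAr hproj_vproj_tr scaler0 mul0mx addr0.
Qed.

Lemma shearK a z : shear (- a) (shear a z) = z.
Proof.
by rewrite {1}/shear hproj_shear /shear -addrA -mulmxDl -scalerDl subrr
           scale0r mul0mx addr0.
Qed.

Lemma is_diff_shear a z :
  is_diff z (shear a)
    (fun v => v + (a *: vproj^T) *m 'd (corr alpha beta) (hproj *m z) (hproj *m v)).
Proof.
have cP := @linear_cV_continuous _ _ _ (mulmx (@hproj R m)).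
have cQ := @linear_cV_continuous _ _ _ (mulmx (a *: (@vproj R m)^T)).
have dP : is_diff z (mulmx (@hproj R m)) (mulmx (@hproj R m)).
  by apply: DiffDef; [exact: linear_differentiable|exact: diff_lin].
have dc : differentiable (corr alpha beta) (hproj *m z).
  by case: (is_diff_corr alpha beta (hproj *m z)).
have dcP := is_diff_comp dP (differentiableP dc).
exact: is_diffD (is_diff_id z)
  (is_diff_linear_comp (L := mulmx (a *: vproj^T)) cQ dcP).
Qed.

Lemma smooth_shear a : smooth_on setT (shear a).
Proof.
move=> k; have cP := @linear_cV_continuous _ _ _ (mulmx (@hproj R m)).
have cQ := @linear_cV_continuous _ _ _ (mulmx (a *: (@vproj R m)^T)).
have cI := @linear_cV_continuous R m.+1.*2 _ idfun.
apply: (CkD openT (@Ck_linear R _ _ k setT idfun cI)).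
apply: (Ck_linear_comp (L := mulmx (a *: vproj^T)) cQ openT).
have := Ck_comp_affine (L := mulmx (@hproj R m)) 0 cP openT (smooth_corr alpha beta k).
apply: Ck_ext; first by rewrite (_ : [set x | _] = setT) //; exact: openT.
by move=> x _; rewrite addr0.
Qed.

Lemma shear_diffeomorphism :
  @diffeomorphism R 'cV[R]_m.+1.*2 'cV[R]_m.+1.*2 setT setT (shear (-1)) (shear 1).
Proof.
split; [exact: openT|exact: openT| | |].
- apply/seteqP; split=> // z _; exists (shear 1 z) => //; exact: shearK.
- by move=> z _; rewrite -{1}[1]opprK shearK.
- by split; exact: smooth_shear.
Qed.

(** By [corr_dbar], the correction contributes exactly the [Lam] term by which J differs from the
    standard structure. *)
Lemma shear_holomorphic : holomorphic_on setT J (@Jst R m.+1) (shear (-1)).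
Proof.
move=> q _; case: (is_diff_shear (-1) q) => d E; split; first exact: d.
move=> v; have {}E x := congr1 (fun F : _ -> _ => F x) E.
apply: etrans (E _) _; apply: etrans (congr1 (mulmx (Jst_mx R m.+1)) (esym (E v))).
rewrite scaleN1r !mulNmx.
set c1 := 'd _ _ _; set c2 := 'd _ _ _.
have cE : toC c1 = 'i%C * toC c2 + Lam alpha beta (hproj *m q) (hproj *m v).
  rewrite /c1 /c2 (hproj_J hJ); exact: corr_dbar.
have hQ (c : 'cV[R]_2) : hproj *m ((@vproj R m)^T *m c) = 0.
  by rewrite mulmxA hproj_vproj_tr mul0mx.
have vQ (c : 'cV[R]_2) : vproj *m ((@vproj R m)^T *m c) = c.
  by rewrite mulmxA vproj_tr mul1mx.
apply: hv_inj.
  by rewrite hproj_Jst !mulmxBr !hQ mulmx0 !subr0 (hproj_J hJ).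
apply: toC_inj; rewrite vproj_Jst !mulmxBr !vQ.
by rewrite !toCB cE (vproj_J hJ hL) fstzE; ring.
Qed.

End GlobalChart.

Section Integrability.
Variables (R : realType) (m : nat) (J : almost_complex_map R m.+1.*2).
Variables (alpha beta : 'I_m -> 'I_m -> R[i]).
Hypotheses (hJ : model_structure J) (hL : associated_functions J alpha beta).

Lemma transversal_beta_sym U (g : 'cV[R]_m.+1.*2 -> 'cV[R]_2) p :
  open U -> U p -> smooth_on U g -> g p = 0 ->
  (forall u : 'cV[R]_2, 'd g p (vproj^T *m u) = 0 -> u = 0) ->
  (forall q, U q -> g q = 0 -> forall v : 'cV[R]_m.+1.*2,
    'd g q v = 0 -> 'd g q (J q *m v) = 0) ->
  forall j k, beta k j = beta j k.
Proof.
move=> oU Up sg gp gv gJ.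
have [W [psi [oW Wp H _ _]]] := graph_lemma hJ hL oU Up sg gp gv gJ.
apply: (graph_beta_sym oW Wp (psi := psi) (alpha := alpha)).
- by move=> w /H[].
- by move=> v; have [_ + _] := H _ Wp; apply.
- by move=> w /H[_ _ +] v; apply.
Qed.

Lemma integrable_beta_sym : integrable_structure J ->
  forall j k, beta k j = beta j k.
Proof.
move=> /(_ 0)[U [U' [f [g [U0 [oU oU' fU fK [sf sg]] hf]]]]].
have df q : U q -> differentiable f q by move=> Uq; exact: (sf 1).1.
have dinj q v : U q -> 'd f q v = 0 -> v = 0.
  move=> Uq fv.
  have U'q : U' (f q) by rewrite -fU; exists q.
  have dgf := is_diff_comp (differentiableP (df q Uq))
    (differentiableP ((sg 1).1 _ U'q)).
  have nid : {near q, g \o f =1 idfun}.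
    have := open_nbhs_nbhs (conj oU Uq).
    by apply: filterS => x Ux; rewrite /= fK // inE.
  case: (near_eq_is_diff nid dgf) => _ E1.
  case: (is_diff_id q) => _ E2.
  have Ev := congr1 (fun F : _ -> _ => F v) (etrans (esym E2) E1).
  apply: etrans Ev _; apply: etrans (congr1 ('d g (f q)) fv) _.
  exact: (linear0 ('d g (f q))).
pose e : 'cV[R]_2 := ofC 1.
(* ['d f 0] is injective, so some component of the chart has nonzero derivative in the vertical
   direction. Its level set through 0 is the transversal hypersurface. *)
have [j cj] : exists j, zcoord ('d f 0 (vproj^T *m e)) j != 0.
  apply: contrapT => /forallNP H.
  have /dinj : 'd f 0 (vproj^T *m e) = 0.
    apply: zcoord_inj => j; rewrite zcoord0.
    by apply/eqP; apply: contrapT => /negP; exact: H.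
  move=> /(_ U0)/(congr1 (mulmx vproj)).
  rewrite mulmxA vproj_tr mul1mx mulmx0 => /(congr1 (@toC R)).
  by rewrite ofCK toC0 => /eqP; rewrite oner_eq0.
pose S := @coord_mx R m.+1 j.
have cS := @linear_cV_continuous _ _ _ (mulmx S).
pose h q := S *m f q + (- (S *m f 0)).
have dh q : U q -> is_diff q h (fun v => S *m 'd f q v).
  move=> Uq; rewrite -[X in is_diff _ _ X]addr0.
  have d := is_diff_linear_comp (L := mulmx S) cS (differentiableP (df q Uq)).
  exact: is_diffD d (is_diff_cst (- (S *m f 0)) q).
have dhE q v : U q -> toC ('d h q v) = zcoord ('d f q v) j.
  move=> Uq; rewrite -toC_coord_mx; case: (dh q Uq) => _ E; congr (toC _).
  exact: (congr1 (fun F : _ -> _ => F v) E).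
have dfJ q v : U q -> zcoord ('d f q (J q *m v)) j = 'i%C * zcoord ('d f q v) j.
  move=> Uq; have [_ HJ] := hf q Uq.
  by rewrite -zcoord_Jst; congr (zcoord _ j); exact: HJ.
apply: (transversal_beta_sym (U := U) (g := h) (p := 0) oU U0).
- move=> k; apply: CkD => //; last exact: Ck_cst.
  exact: (Ck_linear_comp (L := mulmx S) cS oU (sf k)).
- by rewrite /h subrr.
(* J acts on vertical vectors as multiplication by i, so T is complex linear; since T e is nonzero,
   T is injective. *)
- pose T u := zcoord ('d f 0 (vproj^T *m u)) j.
  have TE : forall u v, toC v * T u = toC u * T v.
    apply: toC_linear_eq => [u v|a u|u]; rewrite /T.
    + rewrite -zcoordD; congr (zcoord _ j); rewrite mulmxDr.
      exact: (linearD ('d f 0)).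
    + rewrite -zcoordZ; congr (zcoord _ j); rewrite -scalemxAr.
      exact: linearZZ.
    + by rewrite -(J_vert hJ 0) dfJ.
  move=> u hu; apply: toC_inj; rewrite toC0.
  have := TE u e; rewrite ofCK mul1r.
  have -> : T u = 0 by apply: etrans (esym (dhE _ _ U0)) _; rewrite hu toC0.
  by move=> /esym/eqP; rewrite mulf_eq0 (negbTE cj) orbF => /eqP.
- move=> q Uq _ v hv; apply: toC_inj; rewrite toC0.
  apply: etrans (dhE _ _ Uq) _; rewrite dfJ // -dhE // hv toC0 mulr0 //.
Qed.

Lemma beta_sym_integrable : (forall j k, beta k j = beta j k) ->
  integrable_structure J.
Proof.
move=> bs p; exists setT, setT, (shear alpha beta (-1)), (shear alpha beta 1).
by split; [|exact: shear_diffeomorphism|exact: shear_holomorphic].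
Qed.

End Integrability.

(** * Vertical and transversal points of a hypersurface *)

Definition transversal (R : realType) m (g : 'cV[R]_m.+1.*2 -> 'cV[R]_2) q :=
  forall u : 'cV[R]_2, 'd g q (vproj^T *m u) = 0 -> u = 0.

Definition vertical (R : realType) m (g : 'cV[R]_m.+1.*2 -> 'cV[R]_2) q :=
  forall u : 'cV[R]_2, 'd g q (vproj^T *m u) = 0.

Section Hypersurfaces.
Variables (R : realType) (m : nat) (J : almost_complex_map R m.+1.*2).
Variables (alpha beta : 'I_m -> 'I_m -> R[i]).
Hypotheses (hJ : model_structure J) (hL : associated_functions J alpha beta).
Variables (N : set 'cV[R]_m.+1.*2) (hN : complex_hypersurface J N).

(* The vertical directions form a complex line, on which [ker (dg q)] cuts out a
   complex subspace. *)
Lemma vertical_dichotomy p U g q : local_equation N p U g -> U q -> N q ->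
  transversal g q \/ vertical g q.
Proof.
move=> lg Uq Nq; have gq : g q = 0 by apply/(local_equationE lg Uq).
have [|/existsNP[u /not_implyP[gu u0]]] := pselect (transversal g q).
  by left.
right=> u'.
have u1 : toC u != 0.
  by apply: contra_notN u0 => /eqP E; apply: toC_inj; rewrite E toC0.
have gJu : 'd g q (vproj^T *m (Jst_mx R 1 *m u)) = 0.
  have H := hypersurface_J hN lg Uq gq gu.
  exact: etrans (congr1 ('d g q) (esym (J_vert hJ q u))) H.
have [a [b uE]] : exists a b : R, u' = a *: u + b *: (Jst_mx R 1 *m u).
  case E : (toC u' / toC u) => [a b]; exists a, b; apply: toC_inj.
  rewrite toCD !toCZ toC_Jst -[LHS](divfK u1) E mulrA -mulrDl; congr (_ * _).
  by apply/eqP; rewrite eq_complex /=; apply/andP; split; apply/eqP; ring.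
have vE : (@vproj R m)^T *m u' =
    a *: (vproj^T *m u) + b *: (vproj^T *m (Jst_mx R 1 *m u)).
  by rewrite uE mulmxDr -!scalemxAr.
rewrite vE; apply: etrans (linearD ('d g q) _ _) _.
apply: etrans (congr2 +%R (linearZZ ('d g q) a _) (linearZZ ('d g q) b _)) _.
by rewrite gu gJu !scaler0 addr0.
Qed.

Lemma near_local_equation p U (g : 'cV[R]_m.+1.*2 -> 'cV[R]_2) :
  local_equation N p U g -> \forall q \near p, U q.
Proof. by move=> [oU Up _ _ _]; exact: open_nbhs_nbhs. Qed.

Lemma vertical_cylinder p U g : N p -> local_equation N p U g ->
  (forall q, U q -> N q -> vertical g q) -> cylinder_germ N p.
Proof.
move=> Np lg vert; apply: (cylinder_lemma hJ hN Np lg).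
by apply: filterS (near_local_equation lg) => q; exact: vert.
Qed.

(** A transversal point anywhere in the domain of the local equation forces [beta] to be symmetric,
    hence J to be integrable. So N is vertical on the whole domain. *)
Lemma nonintegrable_cylinder : ~ integrable_structure J ->
  forall p, N p -> cylinder_germ N p.
Proof.
move=> nint p Np; have [U [g lg]] := hN.1 p Np.
apply: (vertical_cylinder Np lg) => q Uq Nq.
have [tq|//] := vertical_dichotomy lg Uq Nq.
have [oU _ sg _ _] := lg.
have gq : g q = 0 by apply/(local_equationE lg Uq).
case: nint; apply: (beta_sym_integrable hJ hL).
exact: (transversal_beta_sym hJ hL oU Uq sg gq tq (hypersurface_J hN lg)).
Qed.

Lemma transversal_graph p U g : (forall j k, beta k j = beta j k) ->
  N p -> local_equation N p U g -> transversal g p -> graph_germ alpha beta N p.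
Proof.
move=> bs Np lg tp; have [oU Up sg _ _] := lg.
have gp : g p = 0 by apply/(local_equationE lg Up).
have [W [psi [oW Wp dpsi near_psi _]]] :=
  graph_lemma hJ hL oU Up sg gp tp (hypersurface_J hN lg).
pose phi w : 'cV[R]_1.*2 := psi w - corr alpha beta w.
have dphi w : W w ->
    is_diff w phi (fun v => 'd psi w v - 'd (corr alpha beta) w v).
  move=> Ww; have [d _ _] := dpsi w Ww.
  have dc : differentiable (corr alpha beta) w by case: (is_diff_corr alpha beta w).
  exact: is_diffB (differentiableP d) (differentiableP dc).
exists W, phi; split=> //.
- by rewrite fstzE.
- move=> w Ww; case: (dphi w Ww) => d E; split; first exact: d.
  move=> v; have {}E x := congr1 (fun F : _ -> _ => F x) E.
  apply: etrans (E _) _; apply: etrans (congr1 (mulmx (Jst_mx R 1)) (esym (E v))).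
  have [_ _ psiJ] := dpsi w Ww.
  have E1 := psiJ v; have E2 := corr_dbar alpha bs w v.
  apply: toC_inj.
  apply: etrans (etrans (toCB _ _) (congr2 (fun x y => x - y) E1 E2)) _.
  apply: etrans (esym (etrans (toC_Jst _) (congr1 ( *%R 'i%C) (toCB _ _)))).
  have cancel (x y l : R[i]) : 'i%C * x + l - ('i%C * y + l) = 'i%C * (x - y) by ring.
  exact: cancel.
apply: filterS2 near_psi (near_local_equation lg) => q Eq Uq.
rewrite (local_equationE lg Uq) Eq lastzE -toC_corr -toCE toCB addrC fstzE.
by rewrite subrK; split=> [->|/toC_inj].
Qed.

Lemma transversal_image p U g q : local_equation N p U g -> U q -> N q ->
  transversal g q -> @fstz R m @` tangent 2 N q = setT.
Proof.
move=> lg Uq Nq tq; rewrite (tangentE Nq (local_equation_at lg Uq)).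
apply/seteqP; split=> // w _.
have [u gu] : exists u : 'cV[R]_2,
    'd g q (vproj^T *m u) = - 'd g q (hproj^T *m w).
  pose f : {linear 'cV[R]_2 -> 'cV[R]_2} := 'd g q \o mulmx vproj^T.
  have finj (u : 'cV[R]_2) : f (1%:M *m u) = 0 -> u = 0 by rewrite mul1mx; exact: tq.
  exact: (surj_of_inj finj).
exists (join w u); last by rewrite fstzE hproj_join.
apply: etrans (linear_join ('d g q) _ _) _.
by apply: etrans (congr1 (+%R _) gu) _; rewrite subrr.
Qed.

Lemma transversal_rank p U g q : local_equation N p U g -> U q -> N q ->
  transversal g q -> projection_rank N q m.*2.
Proof.
move=> lg Uq Nq tq; exists 1%:M; split; first exact: mxrank1.
rewrite (transversal_image lg Uq Nq tq); apply/seteqP; split=> // w _.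
by exists w => //; rewrite mul1mx.
Qed.

Lemma vertical_image p U g q : local_equation N p U g -> U q -> N q ->
  vertical g q ->
  @fstz R m @` tangent 2 N q = [set w | 'd g q (hproj^T *m w) = 0].
Proof.
move=> lg Uq Nq vq; rewrite (tangentE Nq (local_equation_at lg Uq)).
have H v : 'd g q v = 'd g q (hproj^T *m (hproj *m v)).
  rewrite -{1}(joinK v); apply: etrans (linear_join ('d g q) _ _) _.
  by apply: etrans (congr1 (+%R _) (vq _)) _; rewrite addr0.
apply/seteqP; split=> [_ [v gv <-]|w gw].
  by rewrite fstzE; exact: etrans (esym (H v)) gv.
exists (hproj^T *m w) => //.
by rewrite fstzE mulmxA hproj_tr mul1mx.
Qed.

Lemma vertical_surj p U g q : local_equation N p U g -> U q -> vertical g q ->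
  forall w, exists v, 'd g q (hproj^T *m v) = w.
Proof.
move=> [_ _ _ surj _] Uq vq w; have [v gv] := surj q Uq w.
exists (hproj *m v); rewrite -gv; apply: esym; rewrite -{1}(joinK v).
apply: etrans (linear_join ('d g q) _ _) _.
by apply: etrans (congr1 (+%R _) (vq _)) _; rewrite addr0.
Qed.

(** At a vertical point the image of the projection is the kernel of a map from R^{2m} onto R^2.
    This surjectivity forces m >= 1, so the truncated subtraction is exact. *)
Lemma vertical_rank p U g q : local_equation N p U g -> U q -> N q ->
  vertical g q -> projection_rank N q (m.*2 - 2).
Proof.
move=> lg Uq Nq vq.
pose f : {linear 'cV[R]_m.*2 -> 'cV[R]_2} := 'd g q \o mulmx hproj^T.
have [C fC] := @right_inverse _ _ _ f (vertical_surj lg Uq vq).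
pose M := lmx f.
have MC : M *m C = 1%:M.
  apply/matrixP => i j; have := fC (delta_mx j 0).
  rewrite -(mul_lmx f) -/M mulmxA -colE => /(congr1 (fun x : 'cV_2 => x i 0)).
  by rewrite !mxE => ->; rewrite eqxx andbT.
have rM : \rank M = 2.
  apply/eqP; rewrite eqn_leq rank_leq_row /=.
  by have := mxrankM_maxl M C; rewrite MC mxrank1.
have rK : \rank (kermx M^T) = (m.*2 - 2)%N by rewrite mxrank_ker mxrank_tr rM.
rewrite -rK; move: (row_base (kermx M^T)) (eq_row_base (kermx M^T)) => K KE.
exists K^T; split; first by rewrite mxrank_tr KE.
rewrite (vertical_image lg Uq Nq vq).
have fE w : 'd g q (hproj^T *m w) = M *m w by rewrite (mul_lmx f).
apply/seteqP; split=> [w /= gw|_ [D _ <-] /=].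
  have : (w^T <= K)%MS.
    rewrite KE; apply/sub_kermxP; rewrite -trmx_mul.
    by rewrite -[M *m w]fE gw trmx0.
  move=> /submxP[D wD]; exists D^T => //.
  by rewrite -trmx_mul -wD trmxK.
rewrite fE; apply: (can_inj (@trmxK _ _ _)); rewrite trmx0 !trmx_mul trmxK.
by apply/sub_kermxP; apply: submx_trans (submxMl _ _) _; rewrite KE.
Qed.

(** If q were transversal, the image at q would be all of R^{2m}, so r = 2m and the image at p would
    be everything too. Then ['d g p] would vanish on horizontal as well as vertical vectors, against
    its surjectivity. *)
Lemma regular_vertical p U g r : local_equation N p U g -> N p -> vertical g p ->
  projection_rank N p r -> forall q, U q -> N q -> projection_rank N q r ->
  vertical g q.
Proof.
move=> lg Np vp [Bp [rBp BpE]] q Uq Nq [Bq [rBq BqE]].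
have [tq|//] := vertical_dichotomy lg Uq Nq.
have Up : U p by case: lg.
have [C BqC] : exists C : 'M[R]_(r, m.*2),
    forall w : 'cV[R]_m.*2, mulmx Bq (C *m w) = w.
  apply: (@right_inverse _ _ _ (mulmx Bq)) => w.
  have : [set: 'cV[R]_m.*2] w by [].
  by rewrite -(transversal_image lg Uq Nq tq) BqE => -[u _ <-]; exists u.
have rE : r = m.*2.
  apply/eqP; rewrite eqn_leq -{1}rBq rank_leq_row /=.
  have BC : Bq *m C = 1%:M.
    apply/matrixP => i j; have := BqC (delta_mx j 0).
    rewrite mulmxA -colE => /(congr1 (fun x : 'cV_m.*2 => x i 0)).
    by rewrite !mxE => ->; rewrite eqxx andbT.
  by have := mxrankM_maxl Bq C; rewrite BC mxrank1 rBq.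
have /row_freeP[D BpD] : row_free Bp by rewrite /row_free rBp rE.
have zero w : 'd g p (hproj^T *m w) = 0.
  have : range (fun u : 'cV[R]_r => Bp *m u) w.
    by exists (D *m w) => //; rewrite mulmxA BpD mul1mx.
  by rewrite -BpE (vertical_image lg Up Np vp).
have [v gv] := vertical_surj lg Up vp (ofC 1).
have E10 : toC (ofC 1 : 'cV[R]_2) = 0 by rewrite -gv zero toC0.
by exfalso; move/eqP: E10; rewrite ofCK oner_eq0.
Qed.

Lemma integrable_germ : (forall j k, beta k j = beta j k) ->
  forall p, N p -> regular_germ N p ->
  cylinder_germ N p \/ graph_germ alpha beta N p.
Proof.
move=> bs p Np [r rnear]; have [U [g lg]] := hN.1 p Np.
have Up : U p by case: lg.
have [tp|vp] := vertical_dichotomy lg Up Np.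
  by right; exact: transversal_graph lg tp.
left; apply: (cylinder_lemma hJ hN Np lg).
have rp := nbhs_singleton rnear Np.
apply: filterS2 rnear (near_local_equation lg) => q rq Uq Nq.
exact: regular_vertical lg Np vp rp q Uq Nq (rq Nq).
Qed.

Lemma transversal_regular p U g : N p -> local_equation N p U g ->
  transversal g p -> regular_germ N p.
Proof.
move=> Np lg tp; have [oU Up sg _ _] := lg.
have gp : g p = 0 by apply/(local_equationE lg Up).
have [W [psi [_ _ _ _ near_t]]] :=
  graph_lemma hJ hL oU Up sg gp tp (hypersurface_J hN lg).
exists m.*2; apply: filterS2 near_t (near_local_equation lg) => q tq Uq Nq.
exact: transversal_rank lg Uq Nq tq.
Qed.

(** Either N is vertical near p, and p is regular with rank 2m - 2, or every neighbourhood of p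
    contains a transversal point of N, which is regular because transversality is open. *)
Lemma regular_dense : N `<=` closure [set p | N p /\ regular_germ N p].
Proof.
move=> p Np; have [U [g lg]] := hN.1 p Np.
have [vert|nvert] := pselect (\forall q \near p, N q -> vertical g q).
  apply: subset_closure; split=> //; exists (m.*2 - 2)%N.
  apply: filterS2 vert (near_local_equation lg) => q vq Uq Nq.
  exact: vertical_rank lg Uq Nq (vq Nq).
move=> B nB; apply: contrapT => nE; apply: nvert.
apply: filterS2 nB (near_local_equation lg) => q Bq Uq Nq.
have [tq|//] := vertical_dichotomy lg Uq Nq.
case: nE; exists q; split=> //; split=> //.
exact: transversal_regular Nq (local_equation_at lg Uq) tq.
Qed.

End Hypersurfaces.

Theorem proposition2p3 (R : realType) (m : nat)
    (J : almost_complex_map R m.+1.*2) (alpha beta : 'I_m -> 'I_m -> R[i])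
    (hJ : model_structure J) (hL : associated_functions J alpha beta) :
  [/\ integrable_structure J <-> compatible alpha beta,
      integrable_structure J ->
        exists F G, @diffeomorphism R 'cV[R]_m.+1.*2 'cV[R]_m.+1.*2
                      setT setT F G /\
                    holomorphic_on setT J (@Jst R m.+1) F,
      integrable_structure J -> forall N, complex_hypersurface J N ->
        (forall p, N p -> regular_germ N p ->
           cylinder_germ N p \/ graph_germ alpha beta N p) /\
        N `<=` closure [set p | N p /\ regular_germ N p]
    & ~ integrable_structure J -> forall N, complex_hypersurface J N ->
        forall p, N p -> cylinder_germ N p].
Proof.
split.
- split=> [hint|/compatibleP bs].
    by apply/compatibleP; exact: (integrable_beta_sym hJ hL hint).
  exact: (beta_sym_integrable hJ hL bs).
- move=> hint; have bs := integrable_beta_sym hJ hL hint.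
  exists (shear alpha beta (-1)), (shear alpha beta 1).
  by split; [exact: shear_diffeomorphism|exact: (shear_holomorphic hJ hL bs)].
- move=> hint N hN; have bs := integrable_beta_sym hJ hL hint.
  by split; [exact: (integrable_germ hJ hL hN bs)|exact: (regular_dense hJ hL hN)].
- by move=> nint N hN; exact: (nonintegrable_cylinder hJ hL hN nint).
Qed.
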